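(* Let $\mathfrak{F}$ be a saturated formation containing the class $\mathfrak{U}$ of all finite supersolvable groups, and let $G$ be a finite group. Then $G\in\mathfrak{F}$ if and only if there exists a normal subgroup $H$ of $G$ such that $G/H\in\mathfrak{F}$ and, for every prime $p$ and any non-cyclic Sylow $p$-subgroup $P$ of $F^*(H)$, at least one of the following holds: (i) Every maximal subgroup of $P$ not having a supersolvable supplement in $G$ satisfies $(\triangle)$ in $G$. (ii) Every cyclic subgroup $L$ of $P$ of prime order or of order $4$ (when $p=2$, $P$ is non-abelian, and $L\nsubseteq Z_{\infty}(G)$) not having a supersolvable supplement in $G$ satisfies $(\triangle)$ in $G$.
   Context: All groups are finite. A formation is a class $\mathfrak{F}$ of finite groups closed under isomorphism, quotients and such that $G/M,G/N\in\mathfrak{F}$ implies $G/(M\cap N)\in\mathfrak{F}$ for $M,N\unlhd G$; it is saturated if $G/\Phi(G)\in\mathfrak{F}$ implies $G\in\mathfrak{F}$, where $\Phi(G)$ is the Frattini subgroup. $F^*(H)$ is the generalized Fitting subgroup of $H$. $Z_\infty(G)$ is the hypercenter of $G$ (the last term of the upper central series). The parenthetical condition in (ii) qualifies the subgroups of order $4$. A supplement of a subgroup $L$ in $G$ is a subgroup $T\leq G$ with $G=LT$. $(a,b)$ denotes the greatest common divisor of integers $a,b$. Let $L\leq G$. Two subgroups $A,B$ permute if $AB=BA$. - $L$ is S-quasinormal in $G$ if $L$ permutes with every Sylow subgroup of $G$. - $L$ is S-quasinormally embedded in $G$ if every Sylow subgroup of $L$ is a Sylow subgroup of some S-quasinormal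 subgroup of $G$. - $L$ is $\tau$-quasinormal in $G$ if $L$ permutes with all Sylow $q$-subgroups $Q$ of $G$ (for all primes $q$) such that $(q,|L|)=1$ and $(|L|,|Q^G|)\neq 1$, where $Q^G$ is the normal closure of $Q$ in $G$. - $L_{seG}$ is the subgroup generated by all subgroups of $L$ which are S-quasinormally embedded in $G$; $L_{\tau G}$ is the subgroup generated by all subgroups of $L$ which are $\tau$-quasinormal in $G$. - $L$ is weakly S-embedded in $G$ if there is $K\unlhd G$ such that $LK$ is S-quasinormal in $G$ and $L\cap K\leq L_{seG}$. - $L$ is weakly $\tau$-embedded in $G$ if there is $K\unlhd G$ such that $LK$ is S-quasinormal in $G$ and $L\cap K\leq L_{\tau G}$. - $L$ satisfies $(\triangle)$ in $G$ if $L$ is weakly S-embedded or weakly $\tau$-embedded in $G$. *)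

(* Defs.v *)
From mathcomp Require Import all_boot all_fingroup all_solvable.

Set Implicit Arguments.
Unset Strict Implicit.
Unset Printing Implicit Defensive.

Local Open Scope group_scope.

(* A class of finite groups. Invariance under isomorphism is part of            *)
(* [formation] below, so the ambient finGroupType is immaterial.                *)
Definition group_class := forall gT : finGroupType, {group gT} -> Prop.

Definition formation (F : group_class) : Prop :=
  [/\ forall (aT rT : finGroupType) (G : {group aT}) (H : {group rT}),
        G \isog H -> F aT G -> F rT H,
      forall (gT : finGroupType) (G N : {group gT}),
        N <| G -> F gT G -> F _ (G / N)%G
    & forall (gT : finGroupType) (G M N : {group gT}),
        M <| G -> N <| G -> F _ (G / M)%G -> F _ (G / N)%G ->
        F _ (G / (M :&: N))%G].

Definition saturated_formation (F : group_class) : Prop :=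
  formation F /\
  forall (gT : finGroupType) (G : {group gT}), F _ (G / 'Phi(G))%G -> F gT G.

Definition cyclic_factor (gT : finGroupType) (G A B : {set gT}) : bool :=
  invariant_factor G A B && cyclic (B / A).

Definition supersolvable (gT : finGroupType) (G : {group gT}) : Prop :=
  exists2 s : seq {group gT},
    (cyclic_factor G).-series 1%G s & last 1%G s = G.

Section Notions.

Variable gT : finGroupType.
Implicit Types A B : {set gT}.
Implicit Types G H K L P Q T : {group gT}.

Definition quasisimple A : bool := (A^`(1) == A) && simple (A / 'Z(A)).

Definition layer A : {set gT} :=
  <<\bigcup_(K : {group gT} | (K <|<| A) && quasisimple K) K>>.

(* F^*(A) = F(A) E(A), with E(A) the layer. *)
Definition generalized_Fitting A : {set gT} := 'F(A) <*> layer A.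

Canonical layer_group A := [group of layer A].
Canonical generalized_Fitting_group A := [group of generalized_Fitting A].

(* The upper central series is stationary from the index #|A| on; see           *)
(* [hypercenterE] below.                                                        *)
Definition hypercenter A : {set gT} := 'Z_(#|A|)(A).

Definition normal_closure A B : {set gT} := <<class_support A B>>.

Definition permutes A B : bool := A * B == B * A.

(* [Sylow G Q]: Q is a Sylow q-subgroup of G for some prime q ([SylowP]).       *)
Definition s_quasinormal G A : bool :=
  (A \subset G) && [forall (Q : {group gT} | Sylow G Q), permutes A Q].

(* A nontrivial P determines its prime, and P = 1 is a Sylow subgroup of K = 1. *)
Definition s_quasinormally_embedded G L : bool :=
  (L \subset G) &&
  [forall (P : {group gT} | Sylow L P),
     [exists K : {group gT}, s_quasinormal G K && Sylow K P]].

(* Only the primes dividing #|G| matter; see [tau_quasinormalP] below.          *)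
Definition tau_quasinormal G L : bool :=
  (L \subset G) &&
  all (fun q => coprime q #|L| ==>
         [forall (Q : {group gT} | q.-Sylow(G) Q),
            ~~ coprime #|L| #|normal_closure Q G| ==> permutes L Q])
      (primes #|G|).

Definition se_core G L : {set gT} :=
  <<\bigcup_(A : {group gT} | (A \subset L) && s_quasinormally_embedded G A) A>>.

Definition tau_core G L : {set gT} :=
  <<\bigcup_(A : {group gT} | (A \subset L) && tau_quasinormal G A) A>>.

Definition weakly_s_embedded G L : Prop :=
  L \subset G /\
  exists K : {group gT},
    [/\ K <| G, s_quasinormal G (L * K) & L :&: K \subset se_core G L].

Definition weakly_tau_embedded G L : Prop :=
  L \subset G /\
  exists K : {group gT},
    [/\ K <| G, s_quasinormal G (L * K) & L :&: K \subset tau_core G L].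

Definition triangle G L : Prop :=
  weakly_s_embedded G L \/ weakly_tau_embedded G L.

Definition has_supersolvable_supplement G L : Prop :=
  exists T : {group gT}, [/\ T \subset G, L * T = G & supersolvable T].

Lemma hypercenterE G n : #|G| <= n -> 'Z_n(G) = hypercenter G.
Proof.
have stat k m : 'Z_k.+1(G) = 'Z_k(G) -> 'Z_(k + m)(G) = 'Z_k(G).
  by move=> e; elim: m => [|m IH]; rewrite ?addn0 // addnS ucnSn IH -ucnSn.
have [k le_kG e]: exists2 k, k <= #|G| & 'Z_k.+1(G) = 'Z_k(G).
  have: forall m, (exists2 k, k <= m & 'Z_k.+1(G) = 'Z_k(G))
                  \/ m < #|'Z_m.+1(G)|.
    elim=> [|m [[k le_km e]|IH]]; first by right; rewrite cardG_gt0.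
      by left; exists k; rewrite // ltnW.
    have [e|ne] := eqVneq 'Z_m.+2(G) 'Z_m.+1(G); first by left; exists m.+1.
    right; apply: leq_ltn_trans IH _; apply: proper_card.
    by rewrite properEneq eq_sym ne ucn_subS.
  case/(_ #|G|)=> //; rewrite ltnNge subset_leq_card //; exact: ucn_sub.
move=> leGn; rewrite /hypercenter -(subnKC le_kG) -(subnKC (leq_trans le_kG leGn)).
by rewrite !stat.
Qed.

Lemma tau_quasinormalP G L :
  reflect (L \subset G /\
           forall q (Q : {group gT}), prime q -> q.-Sylow(G) Q ->
             coprime q #|L| -> ~~ coprime #|L| #|normal_closure Q G| ->
             L * Q = Q * L)
          (tau_quasinormal G L).
Proof.
apply: (iffP andP) => -[sLG H]; split=> //.
  move=> q Q q_pr sylQ co_qL nco.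
  have [qG|q'G] := boolP (q \in primes #|G|).
    have /implyP/(_ co_qL)/forall_inP/(_ Q sylQ)/implyP/(_ nco) := allP H q qG.
    by move/eqP.
  have Q1 : Q :=: 1.
    apply/eqP; rewrite trivg_card1 (card_Hall sylQ) p_part /= -logn_gt0 in q'G *.
    by rewrite -leqNgt leqn0 in q'G; rewrite (eqP q'G).
  by rewrite Q1 mulg1 mul1g.
apply/allP=> q; rewrite mem_primes => /and3P[q_pr _ _].
apply/implyP=> co_qL; apply/forall_inP=> Q sylQ; apply/implyP=> nco.
by apply/eqP; apply: H co_qL nco.
Qed.

End Notions.

(* Main.v *)
Require Import Defs.
From mathcomp Require Import all_boot all_fingroup all_solvable.
From mathcomp Require Import all_algebra all_field all_character.

(** If [G] is in [F], take [H = 1]. The converse has three stages.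

    First, the layer of [H] is trivial ([layer_trivial]). Suppose that [K] is a
    component of [H], and put [E = F^*(H)] and [C = 'C_E(K)]. Then [E / C] is a
    nonabelian simple quotient of the normal subgroup [E] of [G]. Let [p] be the
    smallest prime divisor of [#|E / C|]. The S-quasinormal subgroups of [G]
    have trivial or full image in [E / C], and [p]-subgroups permuting with
    enough Sylow subgroups have trivial image or a Sylow subgroup as image; both
    follow from Kegel's criterion [Kegel_simple]. Thus a subgroup [L] of a Sylow
    [p]-subgroup [P] of [E] whose image is neither trivial nor Sylow satisfies
    the embedding condition only through a normal subgroup [N] of [G] that
    covers [E / C] while [L :&: N <= C] ([triangle_cases]). For [L] maximal in
    [P] this contradicts the fact that Sylow [p]-subgroups of [E / C] are not
    cyclic. For [L] cyclic of order [p] or [4] in [K] it is impossible because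
    [N] contains [K] and [L] is not in [C]; such an [L] exists, as otherwise the
    theorem of Frobenius would give [K] a normal [p]-complement. Supersolvable supplements
    are excluded in [E / C] by the conjugacy of supersolvable Hall subgroups
    ([maximal_supersolvable_supplement]), respectively by small index
    ([no_small_solvable_index]).

    Secondly, now [F^*(H) = 'F(H)], its Sylow subgroups are the normal subgroups
    [P = 'O_p(H)] of [G], and each of them is hypercyclically embedded in [G]: all
    chief factors of [G] below [P] have order [p]. With [Y = O^p(R)] and [R] the
    smallest normal subgroup with abelian quotient of exponent dividing [p - 1],
    this means that [Y] centralizes [P]. The embedding conditions reduce to
    invariance of subgroups of [P] under O^p(G) ([triangle_norm]). Condition (i)
    is then a statement on hyperplanes in the [G]-module [P / 'Phi(P)], treated by
    induction on submodules ([maximal_hcyc_cent]); condition (ii) is applied in a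
    minimal counterexample, where all nontrivial elements of [P] have order [p]
    or [4] ([small_hcyc_cent]).

    Thirdly, [F] is closed under extensions by normal subgroups of prime order
    ([formation_prime_normal]), so that [G / W] is in [F] whenever [G / E] is and
    all chief factors of [G] between [W] and [E] have prime order. As [G / Y] is of
    this kind over the abelian group [G / R], it is in [F], and so is [G / 'C_G(P)].
    Intersecting with [H] over all [p], [G / D] is in [F] for [D = 'C_H('F(H))],
    which lies in ['F(H)] by Bender's theorem ([cent_Fitting_layer1]). Finally the
    chief factors of [G] below [D] have prime order. *)

Set Implicit Arguments.
Unset Strict Implicit.
Unset Printing Implicit Defensive.

Local Open Scope group_scope.

(** * Coprime action on p-groups *)

Lemma perfect_nil_trivial (gT : finGroupType) (K : {group gT}) :
  K^`(1) = K -> nilpotent K -> K :=: 1.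
Proof.
move=> defK /forall_inP/(_ K)/implyP; rewrite subsetI subxx -derg1 defK subxx /=.
by move/eqP.
Qed.

Lemma prime_dvd2_not_coprime p m n : prime p -> p %| m -> p %| n -> ~~ coprime m n.
Proof.
move=> pr_p pm pn; apply/negP=> co_mn.
by have := prime_gt1 pr_p; rewrite ltnNge dvdn_leq // -(eqP co_mn) dvdn_gcd pm.
Qed.

Section Coprime.

Variable gT : finGroupType.
Implicit Types A G H K P Q R S U V W Y : {group gT}.

(** If a coprime group [A] acts trivially on [G / U], then the fixed points of
    [A] cover [G / U]. *)
Lemma coprime_stable A G U :
    A \subset 'N(G) -> A \subset 'N(U) -> U <| G -> coprime #|G| #|A| ->
  solvable G -> [~: G, A] \subset U -> U * 'C_G(A) = G.
Proof.
move=> nGA nUA nsUG coGA solG sRU.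
have [sUG nUG] := andP nsUG.
have: G / U \subset 'C_G(A) / U.
  rewrite coprime_quotient_cent // subsetI subxx quotient_cents2 //.
rewrite quotientSK // => sG.
by apply/eqP; rewrite eqEsubset sG mul_subG ?subsetIl.
Qed.

(** A coprime action is determined by the action on [G / 'Phi(G)]: the fixed
    points cover that quotient, and the Frattini subgroup consists of
    non-generators. *)
Lemma coprime_cents_Phi A G :
    A \subset 'N(G) -> coprime #|G| #|A| -> solvable G ->
  [~: G, A] \subset 'Phi(G) -> A \subset 'C(G).
Proof.
move=> nGA coGA solG sRU.
have nPA := char_norm_trans (Phi_char G) nGA.
have defG := coprime_stable nGA nPA (Phi_normal G) coGA solG sRU.
have sC : 'Phi(G) <*> 'C_G(A) = G.
  by rewrite norm_joinEr ?defG // (subset_trans (subsetIl _ _)) ?normal_norm ?Phi_normal.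
by have := Phi_nongen sC; rewrite genGid => <-; rewrite centsC subsetIr.
Qed.

End Coprime.

(** For a prime [p] this is O^p(A), the smallest normal subgroup of [A] whose
    quotient is a [p]-group. Generating it by Sylow subgroups fits both uses
    made of it: S-quasinormality speaks of Sylow subgroups, and coprime action
    is available for each generating subgroup separately. *)
Definition p_residual (gT : finGroupType) p (A : {set gT}) : {set gT} :=
  <<\bigcup_(Q : {group gT} | Sylow A Q && p^'.-group Q) Q>>.

Canonical p_residual_group gT p A := [group of @p_residual gT p A].

Section Residual.

Variables (gT : finGroupType) (p : nat).
Implicit Types A G H K P Q R S U V W Y M : {group gT}.

Lemma p_residualP A (M : {group gT}) :
  reflect (forall Q : {group gT}, Sylow A Q -> p^'.-group Q -> Q \subset M)
          (p_residual p A \subset M).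
Proof.
rewrite gen_subG; apply: (iffP bigcupsP) => sQ Q.
  by move=> sylQ p'Q; apply: sQ; rewrite sylQ.
by case/andP; apply: sQ.
Qed.

Lemma p_residual_sub A : p_residual p A \subset A.
Proof. by apply/p_residualP => Q /andP[_ /andP[]]. Qed.

Lemma sub_p_residual A Q : Sylow A Q -> p^'.-group Q -> Q \subset p_residual p A.
Proof. by move=> sylQ p'Q; apply: (p_residualP _ _ (subxx _)). Qed.

Lemma p_residual_norm G A : G \subset 'N(A) -> G \subset 'N(p_residual p A).
Proof.
move=> nAG; apply/subsetP=> x Gx.
rewrite inE -genJ gen_subG; apply/subsetP=> _ /imsetP[y /bigcupP[Q /andP[sylQ p'Q] Qy] ->].
have sylQx : Sylow A (Q :^ x)%G.
  have <-: A :^ x = A by apply/normP/(subsetP nAG).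
  rewrite /Sylow /= p_groupJ /Hall conjSg; have /andP[-> /andP[-> co]] := sylQ.
  by rewrite cardJg indexJg.
apply: (subsetP (sub_p_residual sylQx _)); first by rewrite pgroupJ.
by rewrite /= memJ_conjg.
Qed.

Lemma p_residual_normal A : p_residual p A <| A.
Proof. by rewrite /normal p_residual_sub p_residual_norm ?normG. Qed.

Lemma p_index_residual A : prime p -> p.-nat #|A : p_residual p A|.
Proof.
move=> pr_p; apply/pnatP=> // q pr_q qd; apply/idPn=> /= npq.
have [Q sylQ] := Sylow_exists q A.
have sQ : Q \subset p_residual p A.
  apply: sub_p_residual; first exact: p_Sylow sylQ.
  by apply: pi_pgroup (pHall_pgroup sylQ) _; rewrite !inE.
have: q^'.-nat #|A : Q| by case/and3P: sylQ.
move/(pnat_dvd (indexgS A sQ)).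
by move/pnatP => /(_ (indexg_gt0 _ _) q pr_q qd); rewrite !inE eqxx.
Qed.

Lemma p_residual_mulSylow A S :
  prime p -> p.-Sylow(A) S -> p_residual p A * S = A.
Proof.
move=> pr_p sylS; have [sSA pS _] := and3P sylS.
have nS: S \subset 'N(p_residual p A) by rewrite p_residual_norm // (subset_trans sSA)
  ?normG.
apply: coprime_index_mulG => //; first exact: p_residual_sub.
by apply: pnat_coprime (p_index_residual _ pr_p) _; case/and3P: sylS.
Qed.

(** Trivial action on [P / W] can be tested on the generating Sylow subgroups. *)
Lemma comm_p_residual P A W :
    P \subset 'N(W) -> A \subset 'N(W) ->
    (forall Q, Sylow A Q -> p^'.-group Q -> [~: P, Q] \subset W) ->
  [~: P, p_residual p A] \subset W.
Proof.
move=> nWP nWA sRW; have nWY := subset_trans (p_residual_sub A) nWA.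
rewrite commGC -quotient_cents2 // sub_quotient_pre //.
apply/p_residualP=> Q sylQ p'Q; have sQA : Q \subset A by case/and3P: sylQ => _ ->.
have nWQ := subset_trans sQA nWA.
by rewrite -sub_quotient_pre // quotient_cents2 // commGC sRW.
Qed.

(** A p'-group that acts trivially on both factors of [W <= U <= P] acts trivially
    on [P / W], so O^p(A) behaves as if its action on [p]-groups were coprime. *)
Lemma comm_p_residual_trans P A U W :
    p.-group P -> A \subset 'N(P) -> A \subset 'N(U) -> A \subset 'N(W) ->
    U <| P -> W <| P -> W \subset U ->
    [~: P, p_residual p A] \subset U -> [~: U, p_residual p A] \subset W ->
  [~: P, p_residual p A] \subset W.
Proof.
move=> pP nPA nUA nWA nsUP nsWP sWU sPU sUW.
apply: comm_p_residual => // [|Q sylQ p'Q]; first exact: normal_norm.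
have sQA : Q \subset A by case/and3P: sylQ => _ ->.
have sQY := sub_p_residual sylQ p'Q.
have nW := normal_norm nsWP.
have coPQ : coprime #|P| #|Q| by apply: pnat_coprime pP p'Q.
have nWQ := subset_trans sQA nWA; have sUP := normal_sub nsUP.
have defP : U * 'C_P(Q) = P.
  apply: coprime_stable; rewrite ?(subset_trans sQA) ?(pgroup_sol pP) //.
  exact: subset_trans (commgS _ sQY) sPU.
rewrite -quotient_cents2 // -defP quotientMl ?(subset_trans sUP) //.
rewrite -[U / W * _]/((U / W)%G * ('C_P(Q) / W)%G) mul_subG //.
  rewrite quotient_cents2 ?(subset_trans sUP) //.
  exact: subset_trans (commgS _ sQY) sUW.
by rewrite quotient_cents // subsetIr.
Qed.

Lemma comm_p_residual_Phi P A :
    p.-group P -> A \subset 'N(P) -> 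
    [~: P, p_residual p A] \subset 'Phi(P) -> p_residual p A \subset 'C(P).
Proof.
move=> pP nPA sPhi; apply/p_residualP=> Q sylQ p'Q.
have sQA : Q \subset A by case/and3P: sylQ => _ ->.
apply: coprime_cents_Phi; rewrite ?(subset_trans sQA) ?(pgroup_sol pP) //.
  exact: pnat_coprime pP p'Q.
exact: subset_trans (commgS _ (sub_p_residual sylQ p'Q)) sPhi.
Qed.

End Residual.

(** * Elements of order p and 4 *)

(** The exponent to which commutation with a group of automorphisms forces a
    [p]-group in a minimal situation, see [comm_exponent]: squaring is not an
    endomorphism of a [2]-group of class two, but the fourth power is. *)
Definition small_exponent (gT : finGroupType) p (P : {set gT}) : nat :=
  if (p == 2) && ~~ abelian P then 4 else p.

Definition small_order (gT : finGroupType) p (P : {set gT}) (x : gT) : bool :=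
  (#[x] == p) || [&& #[x] == 4, p == 2 & ~~ abelian P].

Section Small.

Variables (gT : finGroupType) (p : nat).
Hypothesis pr_p : prime p.
Implicit Types A G H K P Q R S U V W Y M : {group gT}.

Lemma expg_small_exponent P (x : gT) :
  x ^+ small_exponent p P = 1 -> x <> 1 -> small_order p P x.
Proof.
rewrite /small_exponent /small_order => + nx1; case: ifP => [/andP[/eqP p2 nab]|_] xn.
  have: #[x] %| 2 ^ 2 by rewrite order_dvdn xn.
  case/(dvdn_pfactor _ _ (isT : prime 2)) => m; case: m => [|[|[|m]]] // _ ox.
  - by case: nx1; apply/eqP; rewrite -order_eq1 ox.
  - by rewrite ox p2.
  by rewrite ox orbT.
have: #[x] %| p by rewrite order_dvdn xn.
case/primeP: pr_p => _ dv /dv /pred2P [/eqP|->]; last by rewrite eqxx.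
by rewrite order_eq1 => /eqP.
Qed.

Lemma abelem_Phi_expg P x : p.-group P -> x \in P -> x ^+ p \in 'Phi(P).
Proof.
move=> pP Px; rewrite (Phi_joing pP) mem_gen // inE (Mho_p_elt 1) ?orbT //.
exact: mem_p_elt pP Px.
Qed.

(** Centralizing ['Phi(P)] makes ['Phi(P)] central by the three subgroup lemma.
    Hence [P] has class at most two with commutators of order dividing [p],
    taking [n]-th powers is an endomorphism with values in ['Phi(P)], and it
    kills every [[~ x, y]] with [y] in [Y]; these commutators generate [P]. *)
Lemma comm_exponent P Y :
    p.-group P -> [~: P, Y] = P -> Y \subset 'C('Phi(P)) ->
  forall x, x \in P -> x ^+ small_exponent p P = 1.
Proof.
move=> pP defP cPhiY; set n := small_exponent p P.
have PhiX x: x \in P -> x ^+ n \in 'Phi(P).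
  move=> Px; rewrite /n /small_exponent; case: ifP => [/andP[/eqP p2 _]|_].
    by rewrite (expgM x 2 2) groupX // -[in x ^+ 2]p2 abelem_Phi_expg.
  exact: abelem_Phi_expg.
have cPhiP : P \subset 'C('Phi(P)).
  apply/commG1P; rewrite -{1}defP [[~: P, Y]]commGC.
  apply: three_subgroup.
    apply/eqP; rewrite -subG1 (subset_trans (commSg _ (_ : _ \subset 'Phi(P)))) //.
      by rewrite commg_subr normal_norm ?Phi_normal.
    by rewrite subG1; apply/eqP/commG1P; rewrite centsC.
  have/commG1P->: 'Phi(P) \subset 'C(Y) by rewrite centsC.
  by rewrite comm1G.
have sRPhi : [~: P, P] \subset 'Phi(P) by rewrite (Phi_joing pP) joing_subl.
have cR x y z : x \in P -> y \in P -> z \in P -> commute z [~ x, y].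
  move=> Px Py Pz; apply: (centsP cPhiP) => //.
  by rewrite (subsetP sRPhi) ?mem_commg.
have Rn x y : x \in P -> y \in P -> [~ x, y] ^+ 'C(n, 2) = 1.
  move=> Px Py.
  have Rp : [~ x, y] ^+ p = 1.
    rewrite -commXg; last exact: cR.
    apply/eqP/commgP/esym/(centsP cPhiP) => //.
    exact: abelem_Phi_expg.
  have [abP|nabP] := boolP (abelian P).
    have/commgP/eqP->: commute x y by apply: (centsP abP).
    by rewrite expg1n.
  rewrite /n /small_exponent nabP andbT.
  case: eqP => [p2|/eqP np2]; first by rewrite (expgM _ 2 3) -[in _ ^+ 2]p2 Rp expg1n.
  have /dvdnP[k ->]: p %| 'C(p, 2).
    by rewrite prime_dvd_bin //= ltn_neqAle eq_sym np2 prime_gt1.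
  by rewrite mulnC expgM Rp expg1n.
have gD : group_set [set x in P | x ^+ n == 1].
  apply/group_setP; split=> [|x y]; first by rewrite inE group1 expg1n eqxx.
  rewrite !inE => /andP[Px /eqP xn] /andP[Py /eqP yn].
  rewrite groupM //= expMg_Rmul ?Rn ?xn ?yn ?mulg1 //; exact: cR.
suff sPD: P \subset Group gD by move=> x /(subsetP sPD); rewrite inE => /andP[_ /eqP].
rewrite -{1}defP gen_subG; apply/subsetP=> _ /imset2P[x y Px Yy ->].
have Pxy: [~ x, y] \in P by rewrite -defP mem_commg.
rewrite inE Pxy /=.
have Pxj: x ^ y \in P by rewrite conjg_mulR groupM.
rewrite commgEl expMg_Rmul; [| by apply: cR; rewrite ?groupV.. ].
rewrite Rn ?groupV // mulg1 expgVn -conjXg (conjgE (x ^+ n)).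
have -> : x ^+ n * y = y * x ^+ n.
  by apply/esym/(centsP cPhiY); rewrite ?PhiX.
by rewrite mulKg mulVg.
Qed.

(** In a minimal counterexample [A] centralizes all proper [A]-invariant
    subgroups of [P] and [[~: P, A] = P], so [comm_exponent] leaves only
    elements that are centralized by hypothesis. *)
Lemma coprime_cent_small A P :
    p.-group P -> p^'.-group A -> A \subset 'N(P) ->
    (forall x, x \in P -> small_order p P x -> x \in 'C(A)) ->
  A \subset 'C(P).
Proof.
have [n] := ubnP #|P|; elim: n P => // n IHn P; rewrite ltnS => lePn pP p'A nPA cA.
have coPA: coprime #|P| #|A| by apply: pnat_coprime pP p'A.
have solP := pgroup_sol pP.
have cprop (U : {group gT}) : U \proper P -> A \subset 'N(U) -> A \subset 'C(U).
  move=> prU nUA; have sUP := proper_sub prU; apply: IHn => //.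
  - exact: leq_trans (proper_card prU) lePn.
  - exact: pgroupS pP.
  move=> x Ux sx; apply: cA; first exact: (subsetP sUP).
  move: sx; rewrite /small_order; case/orP=> [->//|/and3P[-> -> nab]].
  by rewrite (contra (abelianS sUP) nab) orbT.
have nRA : A \subset 'N([~: P, A]) by apply: commg_normr.
have sRP : [~: P, A] \subset P by rewrite commg_subl.
have [defP|prR] := eqVproper sRP; last first.
  have cRA : A \subset 'C([~: P, A]) := cprop [~: P, A]%G prR nRA.
  have defP: [~: P, A] * 'C_P(A) = P.
    apply: coprime_stable => //.
    by rewrite /normal sRP (commg_norml P A).
  by rewrite -defP centM subsetI cRA centsC subsetIr.
have [->|ntP] := eqVneq (P : {set gT}) 1; first by rewrite cents1.
have cPhi := cprop [group of 'Phi(P)] (Phi_proper ntP) (char_norm_trans (Phi_char P) nPA).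
rewrite centsC; apply/subsetP => x Px; have [->|/eqP nx1] := eqVneq x 1;
  first exact: group1.
apply: cA => //; apply: expg_small_exponent => //.
exact: comm_exponent pP defP cPhi _ Px.
Qed.

End Small.

(** * Fusion and normal complements *)

Section Fusion.

Import FiniteModule.

Variables (gT : finGroupType) (p : nat).
Implicit Types A D G H K P Q R S U V W Y M : {group gT}.

(** The case of the focal subgroup theorem where [S] controls its own fusion:
    the transfer from [G] to [S / S^`(1)] sends [g] in [S] to the coset of
    [g ^+ #|G : S|], since each factor of its cycle expansion is conjugate to a
    power of [g]. It kills [G^`(1)], and [#|G : S|] is prime to [#|S|]. *)
Lemma Sylow_der1_fusion G S :
    p.-Sylow(G) S ->
    (forall x u, x \in S -> u \in G -> x ^ u \in S -> [~ x, u] \in S^`(1)) ->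
  S :&: G^`(1) \subset S^`(1).
Proof.
move=> sylS fusS; have [sSG coSiSG] := andP (pHall_Hall sylS).
have nS' : S \subset 'N(S^`(1)) := der_norm 1 S.
pose alpha := restrm_morphism nS' (coset_morphism S^`(1)).
have defA : alpha @* S = S / S^`(1) by rewrite morphim_restrm setIid.
have abA : abelian (alpha @* S) by rewrite defA sub_der1_abelian.
apply/subsetP=> g /setIP[Sg G'g]; have Gg := subsetP sSG g Sg.
have G'ker : G^`(1) \subset 'ker (transfer_morphism G abA).
  rewrite gen_subG; apply/subsetP=> _ /imset2P[h1 h2 Gh1 Gh2 ->].
  rewrite !inE groupR //= morphR //; apply/commgP; apply: GRing.addrC.
have trg0 : transfer G abA g = 0%R by apply: (mker (subsetP G'ker g G'g)).
have trX := transversalP (rcosets_cycle_partition sSG Gg).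
set X := transversal _ _ in trX.
have /and3P[_ sXG _] := trX.
have: (fmod abA (alpha g) *+ #|G : S| = 0)%R.
  rewrite -trg0 (transfer_cycle_expansion sSG abA Gg trX).
  rewrite -(sum_index_rcosets_cycle sSG Gg trX) -GRing.sumrMnr.
  apply: eq_bigr => x Xx; rewrite /restrm /= -fmodX ?mem_morphim //.
  have Sgx : (g ^+ #|<[g]> : S :* x|) ^ x^-1 \in S.
    by rewrite conjgE invgK mulgA -mem_rcoset mulg_exp_card_rcosets.
  congr fmod; rewrite -morphX //= /restrm.
  apply/rcoset_kercosetP; rewrite ?(subsetP nS') ?groupX // mem_rcoset.
  rewrite -{1}[g ^+ _]invgK -conjVg -commgEl fusS ?groupV ?groupX //.
    exact: subsetP sXG x Xx.
  by rewrite conjVg groupV.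
move/(congr1 fmval).
rewrite fmvalZ fmodK ?mem_morphim // fmval0.
move/(congr1 (expgn^~ (expg_invn (alpha @* S) #|G : S|))).
rewrite expg1n expgK ?mem_morphim //; last first.
  exact: coprime_morphl.
by move=> a1; apply: coset_idr a1; rewrite (subsetP nS').
Qed.


Hypothesis pr_p : prime p.

(** Alperin-style induction on the index of [P :&: Q] in [P]. If [D = P :&: Q] is
    proper in [P] and [Q], its normalizers in [P] and [Q] are larger than [D];
    Sylow subgroups of ['N_G(D)] containing them are conjugate by an element of
    ['C(D)], because ['N_G(D)] induces a [p]-group on [D]. *)
Lemma Sylow_conj_cent G P Q :
    (forall U : {group gT}, U \subset G -> p.-group U -> p_residual p 'N_G(U) \subset
      'C(U)) ->
    p.-Sylow(G) P -> p.-Sylow(G) Q ->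
  exists2 c, c \in 'C_G(P :&: Q) & Q :=: P :^ c.
Proof.
move=> frobG; have [n] := ubnP (#|P| - #|P :&: Q|).
elim: n P Q => // n IHn P Q; rewrite ltnS => len sylP sylQ.
have [sPG pP _] := and3P sylP; have [sQG pQ _] := and3P sylQ.
have oPQ : #|P| = #|Q| by rewrite (card_Hall sylP) (card_Hall sylQ).
have [sPQ|nsPQ] := boolP (P \subset Q).
  exists 1; rewrite ?group1 // conjsg1; apply/eqP.
  by rewrite eq_sym eqEcard sPQ oPQ /=.
pose D := (P :&: Q)%G.
have prDP : D \proper P.
  by rewrite properEneq subsetIl andbT; apply: contraNneq nsPQ => /setIidPl.
have prDQ : D \proper Q.
  rewrite properEneq subsetIr andbT; apply: contraNneq nsPQ => /setIidPr sQP.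
  by have/eqP->: P :==: Q; rewrite // eq_sym eqEcard sQP oPQ /=.
have prDNP := nilpotent_proper_norm (pgroup_nil pP) prDP.
have prDNQ := nilpotent_proper_norm (pgroup_nil pQ) prDQ.
pose N := ('N_G(D))%G.
have pNP : p.-group 'N_P(D) := pgroupS (subsetIl _ _) pP.
have pNQ : p.-group 'N_Q(D) := pgroupS (subsetIl _ _) pQ.
have [S1 sylS1 sPS1] := Sylow_superset (setSI 'N(D) sPG : 'N_P(D) \subset N) pNP.
have [S2 sylS2 sQS2] := Sylow_superset (setSI 'N(D) sQG : 'N_Q(D) \subset N) pNQ.
have [x Nx defS2] := Sylow_trans sylS1 sylS2.
have pD : p.-group D := pgroupS (subsetIl _ _) pP.
have sDG : D \subset G := subset_trans (subsetIl _ _) sPG.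
have := frobG D sDG pD; have : x^-1 \in N by rewrite groupV.
rewrite -{1}(p_residual_mulSylow pr_p sylS1) => /mulsgP[c' s resc' S1s defx] cD.
pose c := c'^-1.
have Nc : c \in N by rewrite groupV (subsetP (p_residual_sub _ _) _ resc').
have cDc : c \in 'C_G(D).
  by rewrite inE (subsetP _ _ Nc) ?subsetIl // groupV (subsetP cD).
have defS2c : S2 :=: S1 :^ c.
  by rewrite defS2 -[x]invgK defx invMg conjsgM (conjGid (groupVr S1s)).
have sNG : N \subset G := subsetIl _ _.
have [sS1N pS1 _] := and3P sylS1.
have [R sylR sS1R] := Sylow_superset (subset_trans sS1N sNG) pS1.
have Gc : c \in G by apply: subsetP sNG _ Nc.
have sylRc : p.-Sylow(G) (R :^ c)%G by rewrite pHallJ.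
have IH (A B : {group gT}) : p.-Sylow(G) A -> p.-Sylow(G) B -> #|D| < #|A :&: B| ->
    exists2 c, c \in 'C_G(A :&: B) & B :=: A :^ c.
  move=> sylA sylB ltD; apply: IHn => //; apply: leq_trans len.
  have ->: #|A| = #|P| by rewrite (card_Hall sylA) (card_Hall sylP).
  apply: ltn_sub2l => //; apply: leq_trans ltD _.
  by rewrite (card_Hall sylP) -(card_Hall sylA) subset_leq_card ?subsetIl.
have sPR : 'N_P(D) \subset P :&: R by rewrite subsetI subsetIl (subset_trans sPS1).
have sRQ : 'N_Q(D) \subset (R :^ c)%G :&: Q.
  by rewrite subsetI subsetIl andbT (subset_trans sQS2) // defS2c conjSg.
have [|||a /setIP[Ga cPa] defR] := IH P R => //.
  exact: leq_trans (proper_card prDNP) (subset_leq_card sPR).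
have [|||b /setIP[Gb cQb] defQ] := IH (R :^ c)%G Q => //.
  exact: leq_trans (proper_card prDNQ) (subset_leq_card sRQ).
have cent_sub (A B : {set gT}) y : A \subset B -> y \in 'C(B) -> y \in 'C(A).
  by move=> sAB; apply/subsetP/centS.
exists (a * c * b); last by rewrite defQ /= defR !conjsgM.
have cDa : a \in 'C(D) := cent_sub _ _ _ (subset_trans (proper_sub prDNP) sPR) cPa.
have cDb : b \in 'C(D) := cent_sub _ _ _ (subset_trans (proper_sub prDNQ) sRQ) cQb.
by have /setIP[_ cDc'] := cDc; rewrite inE !groupM.
Qed.

(** The perfect case of the normal p-complement theorem of Frobenius. If [x] and
    [x ^ u] lie in [P], applying [Sylow_conj_cent] to [P] and [P :^ u] replaces
    [u] by an element of ['N_G(P)], and then by one of [P]; so [P = P^`(1)]. *)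
Lemma Frobenius_perfect G :
    (forall U : {group gT}, U \subset G -> p.-group U -> p_residual p 'N_G(U) \subset
      'C(U)) ->
  G^`(1) = G -> p^'.-group G.
Proof.
move=> frobG defG'; have [P sylP] := Sylow_exists p G.
have [sPG pP _] := and3P sylP.
have sP' : P :&: G^`(1) \subset P^`(1).
  apply: (Sylow_der1_fusion sylP) => x u Px Gu Pxu.
  have sylPu : p.-Sylow(G) (P :^ u)%G by rewrite pHallJ.
  have [c /setIP[Gc cPc] defPu] := Sylow_conj_cent frobG sylP sylPu.
  have cxu : x ^ u \in P :&: P :^ u by rewrite inE Pxu memJ_conjg Px.
  have Nuc : u * c^-1 \in 'N_G(P).
    rewrite inE groupM ?groupV //=; apply/normP.
    by rewrite conjsgM [P :^ u]defPu conjsgK.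
  have sylPN : p.-Sylow('N_G(P)) P by rewrite Sylow_subnorm.
  move: Nuc; rewrite -groupV -{1}(p_residual_mulSylow pr_p sylPN).
  case/mulsgP=> c' s resc' Ps def_uc.
  have defxu : x ^ u = x ^ s^-1.
    have cc' y : y \in P -> y ^ c'^-1 = y.
      move=> Py; have cPc' := subsetP (frobG P sPG pP) _ resc'.
      by rewrite conjgE invgK mulgA (centP cPc' y Py) mulgK.
    have : x ^ u = x ^ (u * c^-1).
      by rewrite conjgM [RHS]conjgE invgK mulgA (centP cPc _ cxu) mulgK.
    rewrite -[u * c^-1]invgK def_uc invMg conjgM => ->.
    by rewrite cc' // memJ_norm ?groupV // (subsetP (normG P)).
  by rewrite commgEl defxu -commgEl mem_commg ?groupV.
rewrite defG' (setIidPl sPG) in sP'.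
have P1 : P :=: 1.
  apply: perfect_nil_trivial (pgroup_nil pP).
  by apply/eqP; rewrite eqEsubset der_sub.
by rewrite -partG_eq1 -(card_Hall sylP) P1 cards1.
Qed.

End Fusion.

(** * Permuting subgroups of simple groups *)

Section Permuting.

Variable gT : finGroupType.
Implicit Types A B C D E G H K N P Q R S U V W Y M X : {group gT}.

(** Write [x = b * a] with [b] in [B] and [a] in [A]. *)
Lemma mulG_conj_eq A B G x :
  A \subset G -> B \subset G -> A * B = G -> x \in G -> A * (B :^ x) = G.
Proof.
move=> sAG sBG defG; rewrite -{1}defG (comm_group_setP _) ?defG ?groupP //.
case/mulsgP=> b a Bb Aa ->.
by rewrite conjsgM (conjGid Bb) -{1}(conjGid Aa) -conjsMg defG conjGid // (subsetP sAG).
Qed.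

Lemma permutes_sym (A B : {set gT}) : permutes A B = permutes B A.
Proof. by rewrite /permutes eq_sym. Qed.

Lemma permutesJ (A B : {set gT}) x : permutes (A :^ x) (B :^ x) = permutes A B.
Proof. by rewrite /permutes -!conjsMg (inj_eq (@conjsg_inj _ x)). Qed.

(** The elements [x] of [X = A <*> B] with [C :* x] inside [X * C] form a group
    that contains [A] and [B]. *)
Lemma permutes_join A B C : permutes A C -> permutes B C -> permutes (A <*> B) C.
Proof.
move=> /eqP cAC /eqP cBC; set X := A <*> B.
have gT' : group_set [set x in X | C :* x \subset X * C].
  apply/group_setP; split=> [|x y].
    by rewrite inE group1 /= mulg1; exact: (mulG_subr X C).
  rewrite !inE => /andP[Xx sx] /andP[Xy sy]; rewrite groupM //= rcosetM.
  apply: subset_trans (mulSg [set y] sx) _.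
  rewrite -mulgA; apply: subset_trans (mulgS X sy) _.
  by rewrite mulgA mulGid.
have sXT : X \subset Group gT'.
  rewrite join_subG; apply/andP; split; apply/subsetP=> x xAB; rewrite inE.
    rewrite (subsetP (joing_subl A B)) //=.
    apply: subset_trans (mulSg C (joing_subl A B)).
    by rewrite cAC mulgS ?sub1set.
  rewrite (subsetP (joing_subr A B)) //=.
  apply: subset_trans (mulSg C (joing_subr A B)).
  by rewrite cBC mulgS ?sub1set.
rewrite permutes_sym /permutes eqEcard; apply/andP; split.
  apply/subsetP=> _ /mulsgP[c x Cc Xx ->].
  have: x \in Group gT' := subsetP sXT x Xx.
  by rewrite inE => /andP[_ /subsetP]; apply; rewrite mem_rcoset mulgK.
by rewrite -(card_invg (C * X)) invMg !invGid.
Qed.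

Lemma normal_closure_normal G B : B \subset G -> normal_closure B G <| G.
Proof.
move=> sBG; rewrite /normal gen_subG class_support_subG //=.
by rewrite norms_gen ?class_support_norm.
Qed.

Lemma sub_normal_closure G B : B \subset normal_closure B G.
Proof. exact: subset_trans (sub_class_support G B) (subset_gen _). Qed.

(** Kegel's criterion. Enlarge [A], keeping the hypotheses, as long as possible:
    if some conjugate [B :^ g] does not normalize [A], it contains [x] with
    [A :^ x != A], and [A <*> A :^ x] lies in [A * B :^ g] and still works. At
    the end the normal closure of [B] normalizes [A]. *)
Lemma Kegel_simple G A B :
    simple G -> A \subset G -> B \subset G ->
    (forall x, x \in G -> permutes A (B :^ x)) -> A * B != G ->
  A :=: 1 \/ B :=: 1.
Proof.
move=> /simpleP[ntG simG]; have [n] := ubnP (#|G| - #|A|).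
elim: n A => // n IHn A; rewrite ltnS => len sAG sBG perAB neqG.
have [/forall_inP nAB|/forall_inPn[g Gg]] := boolP [forall g in G, B :^ g \subset 'N(A)].
  have sCl : normal_closure B G \subset 'N(A).
    rewrite gen_subG class_supportEr; apply/bigcupsP=> g Gg; exact: nAB.
  have [Cl1|ClG] := simG [group of normal_closure B G] (normal_closure_normal sBG).
    right; apply/trivgP; move: (sub_normal_closure G B).
    by rewrite /= in Cl1; rewrite Cl1.
  have nsAG : A <| G by rewrite /= in ClG; rewrite /normal sAG -ClG.
  have [->|defA] := simG A nsAG; [by left | case/eqP: neqG].
  by rewrite defA mulGSid.
case/subsetPn=> x Bgx nAx.
have sBgG : B :^ g \subset G by rewrite -(conjGid Gg) conjSg.
have Gx : x \in G by apply: (subsetP sBgG).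
pose A1 := (A <*> A :^ x)%G.
have sAxG : A :^ x \subset G by rewrite -(conjGid Gx) conjSg.
have sA1G : A1 \subset G by rewrite join_subG sAG.
have ltA : #|A| < #|A1|.
  apply: proper_card; rewrite properE joing_subl /= join_subG subxx /=.
  by apply: contra nAx => sAx; rewrite inE.
have perA1 y : y \in G -> permutes A1 (B :^ y).
  move=> Gy; apply: permutes_join; first exact: perAB.
  by rewrite -(permutesJ _ _ x^-1) conjsgK -conjsgM perAB // groupM ?groupV.
have eqM : A1 * (B :^ g) = A * (B :^ g).
  apply/eqP; rewrite eqEsubset; apply/andP; split; last by rewrite mulSg ?joing_subl.
  have /eqP/(@comm_joingE _ A (B :^ g)%G) <- := perAB g Gg.
  rewrite mul_subG ?joing_subr //= join_subG joing_subl /=.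
  have Mx : x \in A <*> B :^ g by rewrite (subsetP (joing_subr _ _)).
  by rewrite -(conjGid Mx) conjSg joing_subl.
have neqA1 : A1 * B != G.
  apply: contra neqG => /eqP defG; apply/eqP.
  have: A * (B :^ g) = G by rewrite -eqM; apply: mulG_conj_eq.
  move/(@mulG_conj_eq A (B :^ g)%G G g^-1 sAG sBgG).
  by rewrite /= conjsgK groupV; apply.
have [|A1_1|] := IHn A1 _ sA1G sBG perA1 neqA1; last by right.
  apply: leq_trans len; apply: ltn_sub2l => //.
  exact: leq_trans ltA (subset_leq_card sA1G).
by left; apply/trivgP; rewrite -A1_1 joing_subl.
Qed.

End Permuting.

(** * Simple groups and S-quasinormal subgroups *)

Section SimpleGroups.

Variable gT : finGroupType.
Implicit Types A B C D E G H K N P Q R S U V W Y M X : {group gT}.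

(** [Aut X] has order [#|X|.-1] when [#|X|] is prime. *)
Lemma norm_prime_cent X Q :
  prime #|X| -> coprime #|Q| #|X|.-1 -> Q \subset 'N(X) -> Q \subset 'C(X).
Proof.
move=> pr_X co nXQ; rewrite -(ker_conj_aut X).
have sQA : conj_aut X @* Q \subset Aut X by apply/subsetP=> _ /morphimP[x _ _ ->];
  exact: Aut_aut.
have [x defX] := cyclicP (prime_cyclic pr_X).
have oA : #|Aut X| = #|X|.-1.
  by rewrite {1}defX card_Aut_cycle -[#[x]]/#|<[x]>| -defX totient_prime.
have: (conj_aut X @* Q) :&: Aut X = 1 by rewrite coprime_TIg // oA; apply: coprime_morphl.
by rewrite (setIidPl sQA) ker_trivg_morphim nXQ => ->; rewrite subxx.
Qed.

Lemma pdiv_coprime_pred G Q p : p = pdiv #|G| -> Q \subset G -> coprime #|Q| p.-1.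
Proof.
move=> -> sQG; have [G1|ntG] := eqVneq #|G| 1%N.
  by move: sQG; rewrite (card1_trivg G1) => /trivgP->; rewrite cards1 coprime1n.
have pr_p : prime (pdiv #|G|) by rewrite pdiv_prime // ltn_neqAle eq_sym ntG cardG_gt0.
rewrite coprime_has_primes ?cardG_gt0 ?(ltn_predRL, prime_gt1) //.
  apply/hasPn => q; rewrite !mem_primes => /and3P[pr_q _ dq].
  rewrite pr_q cardG_gt0 /=; apply/negP=> dqQ.
  have := pdiv_min_dvd (prime_gt1 pr_q) (dvdn_trans dqQ (cardSg sQG)).
  have := dvdn_leq _ dq; rewrite ltn_predRL prime_gt1 // => /(_ isT) leq_q.
  by rewrite leqNgt -(ltn_predK (prime_gt1 pr_p)) ltnS leq_q.
Qed.

(** For the smallest prime divisor [p] of [#|G|], a p'-subgroup that normalizes a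
    cyclic [p]-subgroup acts trivially on its subgroup of order [p], hence on all
    of it; if the Sylow [p]-subgroups were cyclic, [Frobenius_perfect] would
    apply. *)
Lemma perfect_Sylow_pdiv_noncyclic G P p :
  G^`(1) = G -> G :!=: 1 -> p = pdiv #|G| -> p.-Sylow(G) P -> ~~ cyclic P.
Proof.
move=> defG' ntG def_p sylP; apply/negP=> cycP.
have pr_p : prime p by rewrite def_p pdiv_prime // cardG_gt1.
have: p^'.-group G.
  apply: Frobenius_perfect => // U sUG pU.
  apply/p_residualP=> Q sylQ p'Q.
  have sQN : Q \subset 'N_G(U) by case/and3P: sylQ => _ ->.
  have /subsetIP[sQG nUQ] := sQN.
  have [x Gx sUxP] := Sylow_Jsub sylP sUG pU.
  have cycU : cyclic U by rewrite -(cyclicJ U x) (cyclicS sUxP).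
  apply: (coprime_cent_small pr_p pU p'Q nUQ) => y Uy;
    rewrite /small_order cyclic_abelian //= !andbF orbF => /eqP oy.
  rewrite -sub_cent1 -cent_cycle; apply: norm_prime_cent.
  - by rewrite -orderE oy.
  - by rewrite -orderE oy; apply: pdiv_coprime_pred sQG.
  have: <[y]> \char U by rewrite (sub_cyclic_char _ cycU) cycle_subG.
  by move/char_norm_trans; apply.
move/pgroupP/(_ p pr_p); rewrite def_p pdiv_dvd => /(_ isT).
by rewrite !inE eqxx.
Qed.

Lemma s_quasinormalP G A :
  reflect (A \subset G /\ forall Q, Sylow G Q -> permutes A Q) (s_quasinormal G A).
Proof.
by apply: (iffP andP) => -[sAG /forall_inP perA]; split=> //; apply/forall_inP.
Qed.

Lemma simple_perfect G : simple G -> ~~ abelian G -> G^`(1) = G.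
Proof.
move=> /simpleP[_ simG] nab; have [/derG1P abG|//] := simG _ (der_normal 1 G).
by rewrite abG in nab.
Qed.

Lemma perfect_not_pgroup G (p : nat) : G^`(1) = G -> G :!=: 1 -> ~~ p.-group G.
Proof.
move=> defG ntG; apply: contra ntG => pG.
by apply/eqP/perfect_nil_trivial => //; apply: pgroup_nil pG.
Qed.

(** The core of Kegel's theorem that S-quasinormal subgroups are subnormal. By
    [Kegel_simple], a nontrivial [B] has [B * Q = G] for every Sylow subgroup [Q]
    outside [B]; then [#|G : B|] is a power of a prime [q], all Sylow subgroups
    for other primes lie in [B], and they generate [G]. *)
Lemma s_quasinormal_simple G B :
  simple G -> ~~ abelian G -> s_quasinormal G B -> B :=: 1 \/ B :=: G.
Proof.
move=> simG nabG /s_quasinormalP[sBG perB].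
have [[ntG simpG] perfG] := (simpleP _ simG, simple_perfect simG nabG).
have [->|neqBG] := eqVneq (B : {set gT}) G; [by right | left].
have /subsetPn[x Gx nBx] : ~~ (G \subset B).
  by apply: contra neqBG => sGB; rewrite eqEsubset sBG.
have [Q sylQ nsQB] : exists2 Q : {group gT}, Sylow G Q & ~~ (Q \subset B).
  apply/exists_inP; apply: contraR nBx => /exists_inPn sQ.
  apply: subsetP Gx; rewrite -(Sylow_gen G) gen_subG; apply/bigcupsP=> Q sylQ.
  by move: (sQ Q sylQ); rewrite negbK.
have [q pr_q qsylQ] := SylowP _ _ sylQ.
have ntQ : Q :!=: 1 by apply: contraNneq nsQB => ->; apply: sub1G.
have sQG := pHall_sub qsylQ.
have [defG|neqG] := eqVneq (B * Q) G; last first.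
  have [y Gy|//|/eqP] := Kegel_simple simG sBG sQG _ neqG.
    by apply: perB; rewrite SylowJ.
  by rewrite (negPf ntQ).
have iB : q.-nat #|G : B|.
  have [_ qQ _] := and3P qsylQ.
  by apply: pnat_dvd qQ; rewrite -{1}defG indexMg -indexgI dvdn_indexg.
have sYB : p_residual q G \subset B.
  apply/p_residualP=> R sylR q'R.
  have sRG : R \subset G by case/and3P: sylR => _ ->.
  have iBR : q.-nat #|R : B|.
    apply: pnat_dvd iB; rewrite -indexMg -(comm_joingE (eqP (perB R sylR))).
    by rewrite indexSg ?joing_subl // join_subG sBG.
  rewrite -indexg_eq1; apply/eqP/(pnat_1 iBR); rewrite -indexgI.
  exact: pnat_dvd (dvdn_indexg _ _) q'R.
have nsY := p_residual_normal q G.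
have [Y1|YG] := simpG [group of p_residual q G] nsY.
  have := perfect_not_pgroup q perfG ntG; have := p_index_residual G pr_q.
  by rewrite /= in Y1; rewrite Y1 indexg1 /pgroup => ->.
by rewrite /= in YG; rewrite YG in sYB; rewrite (subset_trans sQG) in nsQB.
Qed.

(** With [M = A * Q], the index of [A :&: E] in [M :&: E] is a power of [q] and
    [Q :&: E] is a Sylow [q]-subgroup of [M :&: E], so their product is
    [M :&: E]. *)
Lemma permutes_setI_normal G E A Q q :
    E <| G -> A \subset G -> q.-Sylow(G) Q -> permutes A Q ->
  permutes (A :&: E) (Q :&: E).
Proof.
move=> nsEG sAG sylQ /eqP perAQ; have [sQG qQ _] := and3P sylQ.
have [sEG nEG] := andP nsEG.
pose M := (A <*> Q)%G; have defM : A * Q = M by rewrite /= comm_joingE.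
have sMG : M \subset G by rewrite join_subG sAG.
have sylQM : q.-Sylow(M) Q by apply: pHall_subl sylQ; rewrite ?joing_subr.
have nsIM : M :&: E <| M by rewrite /normal subsetIl normsI ?normG // (subset_trans sMG).
have sylQI : q.-Sylow(M :&: E) (Q :&: E).
  have <-: M :&: E :&: Q = Q :&: E by rewrite setIAC (setIidPr (joing_subr A Q)).
  exact: Sylow_setI_normal nsIM sylQM.
have sAI : A :&: E \subset M :&: E by rewrite setSI // joing_subl.
have iA : q.-nat #|M :&: E : A :&: E|.
  have: q.-nat #|M : A|.
    rewrite -defM indexMg -indexgI; exact: pnat_dvd (dvdn_indexg _ _) qQ.
  apply: pnat_dvd; have -> : A :&: E = (M :&: E) :&: A by rewrite setIAC (setIidPr
    (joing_subl _ _)).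
  rewrite indexgI -indexMg -norm_joinEl ?indexSg ?joing_subl //.
    by rewrite join_subG joing_subl subsetIl.
  exact: subset_trans (joing_subl _ _) (normal_norm nsIM).
have defI : (A :&: E) * (Q :&: E) = M :&: E.
  apply: coprime_index_mulG => //; first exact: pHall_sub sylQI.
  by apply: pnat_coprime iA _; case/and3P: sylQI.
by apply/eqP/comm_group_setP; rewrite defI groupP.
Qed.

End SimpleGroups.

Section QuasinormalTransfer.

Variable gT : finGroupType.
Implicit Types A B C D E G H K L N P Q R S U V W Y M X : {group gT}.

Lemma Sylow_of_normal G E Q q :
    E <| G -> q.-Sylow(E) Q ->
  exists2 R : {group gT}, q.-Sylow(G) R & Q :=: R :&: E.
Proof.
move=> nsEG sylQ; have [sQE qQ _] := and3P sylQ.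
have [R sylR sQR] := Sylow_superset (subset_trans sQE (normal_sub nsEG)) qQ.
exists R => //; have sylI := Sylow_setI_normal nsEG sylR.
apply/eqP; rewrite eqEcard subsetI sQR sQE /=.
by rewrite setIC (card_Hall sylI) (card_Hall sylQ).
Qed.

Lemma s_quasinormal_setI G E A :
  E <| G -> s_quasinormal G A -> s_quasinormal E (A :&: E).
Proof.
move=> nsEG /s_quasinormalP[sAG perA].
apply/s_quasinormalP; split=> [|Q /SylowP[q pr_q sylQ]]; first exact: subsetIr.
have [R sylR ->] := Sylow_of_normal nsEG sylQ.
exact: permutes_setI_normal nsEG sAG sylR (perA R (p_Sylow sylR)).
Qed.

Lemma Sylow_of_quotient E C q (Q : {group coset_of C}) :
    C <| E -> q.-Sylow(E / C) Q ->
  exists2 R : {group gT}, q.-Sylow(E) R & Q :=: R / C.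
Proof.
move=> nsCE sylQ; have [R sylR] := Sylow_exists q E.
have nCE := normal_norm nsCE; have sRE := pHall_sub sylR.
have nCR := subset_trans sRE nCE.
have sylRC : q.-Sylow(E / C) (R / C)%G by apply: quotient_pHall.
have [_ /morphimP[x Nx Ex ->] ->] := Sylow_trans sylRC sylQ.
by exists (R :^ x)%G; rewrite ?pHallJ // quotientJ.
Qed.

Lemma permutes_quotient A B C :
  A \subset 'N(C) -> B \subset 'N(C) -> permutes A B -> permutes (A / C) (B / C).
Proof. by move=> nCA nCB /eqP AB; rewrite /permutes -!quotientMl ?AB. Qed.

Lemma s_quasinormal_quotient E C A :
  C <| E -> s_quasinormal E A -> s_quasinormal (E / C) (A / C).
Proof.
move=> nsCE /s_quasinormalP[sAE perA]; have nCE := normal_norm nsCE.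
apply/(@s_quasinormalP _ (E / C)%G (A / C)%G); split=> [|Q /SylowP[q pr_q sylQ]];
  first exact: quotientS.
have [R sylR ->] := Sylow_of_quotient nsCE sylQ.
rewrite permutes_quotient ?(subset_trans sAE) ?perA ?(p_Sylow sylR) //.
exact: subset_trans (pHall_sub sylR) nCE.
Qed.

Lemma s_quasinormally_embedded_Sylow G U p :
    prime p -> p.-group U -> U :!=: 1 -> s_quasinormally_embedded G U ->
  exists2 K : {group gT}, s_quasinormal G K & p.-Sylow(K) U.
Proof.
move=> pr_p pU ntU /andP[_ /forall_inP embU].
have sylUU : Sylow U U by rewrite /Sylow (pgroup_p pU) /Hall subxx indexgg coprimen1.
have /exists_inP[K sqK sylUK] := embU U sylUU; exists K => //.
have [q pr_q sylq] := SylowP _ _ sylUK; have [_ qU _] := and3P sylq.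
have [_ pdU _] := pgroup_pdiv pU ntU.
by have /eqnP-> : p \in (q : nat_pred) := pgroupP qU p pr_p pdU.
Qed.

End QuasinormalTransfer.

(** * Embedding conditions over a simple quotient *)

Section SimpleTopFactor.

Variables (gT : finGroupType) (G E C : {group gT}) (p : nat).
Hypotheses (nsEG : E <| G) (nsCE : C <| E).
Hypotheses (simS : simple (E / C)) (nabS : ~~ abelian (E / C)).
Implicit Types A D K L M N P Q U : {group gT}.

Let sEG := normal_sub nsEG.
Let sCE := normal_sub nsCE.
Let nCE := normal_norm nsCE.
Let ntS : E / C != 1. Proof. by case/simpleP: simS. Qed.
Let perfS : (E / C)^`(1) = E / C. Proof. exact: simple_perfect. Qed.

Lemma simple_quotient_normal N : N <| E -> N / C = 1 \/ N / C = E / C.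
Proof.
move=> nsNE; have [_ sim] := simpleP _ simS.
by apply: (sim (N / C)%G); apply: quotient_normal.
Qed.

Lemma simple_quotient_s_quasinormal A :
  s_quasinormal G A -> (A :&: E) / C = 1 \/ (A :&: E) / C = E / C.
Proof.
move=> sqA; have sqI := s_quasinormal_setI nsEG sqA.
apply: (s_quasinormal_simple simS nabS (B := ((A :&: E) / C)%G)).
exact: s_quasinormal_quotient.
Qed.

Lemma quotient1_sub A : A \subset E -> A / C = 1 -> A \subset C.
Proof. by move=> sAE A1; rewrite -quotient_sub1 ?A1 // (subset_trans sAE). Qed.

Hypotheses (pr_p : prime p) (pdS : p %| #|E / C|).

(** If [U] is a Sylow subgroup of the S-quasinormal [K], then the image of
    [K :&: E] in the simple group [E / C] is trivial or everything, and in the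
    second case [U / C] is a Sylow subgroup. *)
Lemma s_quasinormally_embedded_sub U :
    U \subset E -> p.-group U -> s_quasinormally_embedded G U ->
    ~~ p.-Sylow(E / C) (U / C) ->
  U \subset C.
Proof.
move=> sUE pU embU nsylU.
have [->|ntU] := eqVneq (U : {set gT}) 1; first exact: sub1G.
have [K sqK sylU] := s_quasinormally_embedded_Sylow pr_p pU ntU embU.
have sUK := pHall_sub sylU.
have [I1|IS] := simple_quotient_s_quasinormal sqK.
  apply: subset_trans (quotient1_sub (subsetIr _ _) I1).
  by rewrite subsetI sUK.
case/negP: nsylU; rewrite -IS; apply: quotient_pHall; first exact: subset_trans nCE.
by apply: pHall_subl sylU; rewrite ?subsetIl // subsetI sUK.
Qed.

(** The image of [U] in [E / C] permutes with all Sylow [q]-subgroups, for any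
    prime divisor [q != p] of the order: normal closures of Sylow [q]-subgroups
    of [G] cover [E / C], so their orders are divisible by [p]. Unless [U / C]
    is a Sylow subgroup, these products are proper and [Kegel_simple] applies. *)
Lemma tau_quasinormal_sub U :
    U \subset E -> p.-group U -> tau_quasinormal G U ->
    ~~ p.-Sylow(E / C) (U / C) ->
  U \subset C.
Proof.
move=> sUE pU /tau_quasinormalP[sUG perU] nsylU; apply/idPn=> nsUC.
have nCU := subset_trans sUE nCE.
have/negP[] := perfect_not_pgroup p perfS ntS.
apply/pgroupP=> q pr_q qS; apply/idPn => neq_qp.
have p'q : q != p by [].
have ntU : U :!=: 1 by apply: contraNneq nsUC => ->; apply: sub1G.
have [_ pdU _] := pgroup_pdiv pU ntU.
have sylQS Q : q.-Sylow(G) Q -> q.-Sylow(E / C) ((Q :&: E) / C).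
  move=> sylQ; apply: quotient_pHall; first by rewrite (subset_trans (subsetIr _ _)).
  by rewrite /= setIC; apply: Sylow_setI_normal nsEG sylQ.
have ntQS Q : q.-Sylow(G) Q -> (Q :&: E) / C != 1.
  move=> /sylQS sylQ; rewrite -cardG_gt1 (card_Hall sylQ) p_part_gt1.
  by rewrite mem_primes pr_q cardG_gt0.
have perQ Q : q.-Sylow(G) Q -> permutes (U / C) ((Q :&: E) / C).
  move=> sylQ; have sQG := pHall_sub sylQ.
  apply: permutes_quotient => //; first by rewrite (subset_trans (subsetIr _ _)).
  rewrite -{1}(setIidPl sUE); apply: (permutes_setI_normal nsEG sUG sylQ).
  apply/eqP/(perU q) => //.
    rewrite prime_coprime //; apply: contra neq_qp; exact: (pgroupP pU).
  pose N := [group of normal_closure Q G].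
  have nsNG : N <| G := normal_closure_normal sQG.
  have sQN : Q \subset N := sub_normal_closure G Q.
  have nsNE : N :&: E <| E by rewrite setIC; apply: normalGI sEG nsNG.
  have [N1|NS] := simple_quotient_normal nsNE.
    case/negP: (ntQS Q sylQ); rewrite -subG1 -N1 quotientS //.
    by rewrite setSI.
  have pdN : p %| #|N|.
    apply: dvdn_trans pdS _; rewrite -NS; apply: dvdn_trans (dvdn_quotient _ _) _.
    by rewrite cardSg ?subsetIl.
  exact: prime_dvd2_not_coprime pdU pdN.
have [Q sylQ] := Sylow_exists q G.
pose Qb := ((Q :&: E) / C)%G.
have sQbS : Qb \subset E / C by rewrite quotientS ?subsetIr.
have [xb||U1|Q1] := @Kegel_simple _ (E / C)%G (U / C)%G Qb simS (quotientS C sUE) sQbS.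
- case/morphimP=> x Nx Ex ->; rewrite /= -quotientJ // conjIg (conjGid Ex).
  apply: (perQ (Q :^ x)%G); rewrite pHallJ //; exact: subsetP Ex.
- apply: contra nsylU => /eqP defS.
  rewrite /pHall quotientS // quotient_pgroup //= -defS indexMg -indexgI.
  have [_ qQb _] := and3P (sylQS Q sylQ).
  apply: pnat_dvd (dvdn_indexg _ _) _; apply: pi_pgroup qQb _.
  by rewrite !inE.
- by case/negP: nsUC; apply: quotient1_sub.
by case/eqP: (ntQS Q sylQ).
Qed.

Lemma core_sub (emb : {group gT} -> bool) L :
    (forall U, U \subset E -> p.-group U -> emb U -> ~~ p.-Sylow(E / C) (U / C) -> U
      \subset C) ->
    L \subset E -> p.-group L -> ~~ p.-Sylow(E / C) (L / C) ->
  <<\bigcup_(A : {group gT} | (A \subset L) && emb A) A>> \subset C.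
Proof.
move=> subC sLE pL nsylL; rewrite gen_subG; apply/bigcupsP=> U /andP[sUL embU].
apply: subC => //; first exact: subset_trans sUL sLE.
  exact: pgroupS pL.
apply: contra nsylL => sylU.
have <- // : U / C = L / C.
apply/esym/(sub_pHall sylU); rewrite ?quotientS //.
exact: quotient_pgroup.
Qed.

(** Whichever core occurs in the definition, it lies in [C], so [L :&: N] does.
    If [N] does not cover [E / C] then [N :&: E <= C] and the image of
    [L * N :&: E] is [L / C]: an S-quasinormal [p]-subgroup of a simple group. *)
Lemma triangle_cases L :
    triangle G L -> L \subset E -> p.-group L -> ~~ p.-Sylow(E / C) (L / C) ->
  exists2 N : {group gT}, N <| G /\ L :&: N \subset C
    & L \subset C \/ (N :&: E) / C = E / C.
Proof.
move=> triL sLE pL nsylL; have nCL := subset_trans sLE nCE.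
have [N [nsNG sqLN sIC]] : exists N : {group gT},
    [/\ N <| G, s_quasinormal G (L * N) & L :&: N \subset C].
  have seC := core_sub s_quasinormally_embedded_sub sLE pL nsylL.
  have tauC := core_sub tau_quasinormal_sub sLE pL nsylL.
  case: triL => -[sLG [N [nsNG sqLN sIL]]]; exists N; split=> //.
    exact: subset_trans sIL seC.
  exact: subset_trans sIL tauC.
exists N => //; have [sNG nNG] := andP nsNG.
have nsNE : N :&: E <| E by rewrite setIC; apply: normalGI sEG nsNG.
have [N1|] := simple_quotient_normal nsNE; [left | by right].
have sNEC := quotient1_sub (subsetIr N E) N1.
have nNL := subset_trans (subset_trans sLE sEG) nNG.
rewrite -(norm_joinEl nNL) in sqLN.
have defI : (L <*> N)%G :&: E = L * (N :&: E) by rewrite /= norm_joinEl // group_modl.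
have defQ : ((L <*> N)%G :&: E) / C = L / C.
  by rewrite defI quotientMl // N1 mulg1.
have := simple_quotient_s_quasinormal sqLN; rewrite defQ => -[L1|LS].
  exact: quotient1_sub.
by case/negP: (perfect_not_pgroup p perfS ntS); rewrite /= -LS quotient_pgroup.
Qed.

Hypothesis def_p : p = pdiv #|E / C|.

Lemma Sylow_quotient_noncyclic P : p.-Sylow(E) P -> ~~ cyclic (P / C).
Proof.
move=> sylP; apply: (@perfect_Sylow_pdiv_noncyclic _ (E / C)%G (P / C)%G p) => //.
by apply: quotient_pHall => //; exact: subset_trans (pHall_sub sylP) nCE.
Qed.

(** In both cases of [triangle_cases] a Sylow [p]-subgroup of [E / C] would have
    order dividing [#|P : M| = p], hence be cyclic. *)
Lemma maximal_not_triangle P M :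
  p.-Sylow(E) P -> maximal M P -> P :&: C \subset M -> ~ triangle G M.
Proof.
move=> sylP maxM sPCM triM; have [sPE pP _] := and3P sylP.
have prMP := maxgroupp maxM; have sMP := proper_sub prMP.
have sME := subset_trans sMP sPE; have pM := pgroupS sMP pP.
have nCP := subset_trans sPE nCE; have nCM := subset_trans sME nCE.
have iM : #|P : M| = p := p_maximal_index pP maxM.
have cycp (D : {group gT}) : D \subset 'N(C) -> #|D : C| %| p -> cyclic (D / C).
  move=> nCD; rewrite -card_quotient //; case/primeP: pr_p => _ dv /dv /pred2P[D1|Dp].
    by rewrite (card1_trivg D1) cyclic1.
  by apply: prime_cyclic; rewrite Dp.
have nsylM : ~~ p.-Sylow(E / C) (M / C).
  apply/negP=> sylM.
  have: P / C \subset M / C.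
    have <- // : P / C = M / C.
    by apply: (sub_pHall sylM); rewrite ?quotientS ?quotient_pgroup.
  rewrite quotientSK // => /subsetP sPCM'.
  case/andP: prMP => _ /subsetPn[x Px]; case/mulsgP: (sPCM' x Px) => c m Cc Mm def_x.
  rewrite def_x groupMr // (subsetP sPCM) // inE Cc andbT.
  by rewrite -(groupMr _ (subsetP sMP m Mm)) -def_x.
have [N [nsNG sMNC] [sMC|NS]] := triangle_cases triM sME pM nsylM.
  case/negP: (Sylow_quotient_noncyclic sylP); apply: cycp => //.
  by rewrite -indexgI -[X in _ %| X]iM indexgS // subsetI sMP.
have nsNE : N :&: E <| E by rewrite setIC; apply: normalGI sEG nsNG.
pose D := (N :&: E :&: P)%G.
have sDP : D \subset P := subsetIr _ _.
have nCD := subset_trans sDP nCP.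
have sylD : p.-Sylow((N :&: E) / C) (D / C).
  by apply: quotient_pHall => //; apply: Sylow_setI_normal nsNE sylP.
have := @perfect_Sylow_pdiv_noncyclic _ (E / C)%G (D / C)%G p perfS ntS def_p.
rewrite /= -{1}NS => /(_ sylD)/negP[]; apply: cycp => //.
rewrite -indexgI; apply: (@dvdn_trans #|D : D :&: M|).
  rewrite indexgS // subsetI subsetIl; apply: subset_trans sMNC.
  rewrite subsetI subsetIr; apply/subsetP=> x /setIP[/setIP[/setIP[]]].
  by [].
have nsMP := p_maximal_normal pP maxM.
rewrite indexgI -indexMg -norm_joinEr; last exact: subset_trans sDP (normal_norm nsMP).
by rewrite -[X in _ %| X]iM indexSg ?joing_subl // join_subG sMP.
Qed.

End SimpleTopFactor.

(** * Supersolvable groups *)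

Lemma cyclic_quotientP (gT : finGroupType) (A B : {group gT}) :
  A <| B -> reflect (exists2 x, x \in B & A * <[x]> = B) (cyclic (B / A)).
Proof.
move=> /andP[sAB nAB]; apply: (iffP cyclicP) => [[xb defBA]|[x Bx <-]].
  have : xb \in B / A by rewrite defBA cycle_id.
  case/morphimP=> x Nx Bx defx; exists x => //.
  rewrite -quotientK ?cycle_subG // quotient_cycle //.
  by rewrite -[coset A x]defx -defBA quotientGK // /normal sAB.
exists (coset A x); rewrite quotientMidl quotient_cycle //.
exact: subsetP Bx.
Qed.

Section Supersolvable.

Variable gT : finGroupType.
Implicit Types A B C D E G H K L N P Q R S T U V W Y M X : {group gT}.

Lemma cyclic_factorI G A B X :
  X \subset G -> cyclic_factor G A B -> cyclic_factor X (A :&: X) (B :&: X).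
Proof.
move=> sXG /andP[/and3P[nAG nBG nsAB] cycBA].
have [sAB nAB] := andP nsAB.
have nAX := subset_trans sXG nAG; have nBX := subset_trans sXG nBG.
have nsI : A :&: X <| B :&: X.
  rewrite /normal setSI //=; apply: normsI; first exact: subset_trans (subsetIl _ _) nAB.
  by rewrite subIset // normG orbT.
apply/andP; split; first by rewrite /invariant_factor !normsI ?normG.
have nA_BX : B :&: X \subset 'N(A) by rewrite (subset_trans (subsetIl _ _)).
have -> : A :&: X = A :&: (B :&: X) by rewrite setIA (setIidPl sAB).
rewrite (isog_cyclic (second_isog nA_BX)).
by apply: cyclicS cycBA; rewrite quotientS ?subsetIl.
Qed.

Lemma supersolvableS G X : X \subset G -> supersolvable G -> supersolvable X.
Proof.
move=> sXG [s sers lasts]; exists [seq (K :&: X)%G | K <- s].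
  have -> : 1%G = (1 :&: X)%G :> {group gT} by apply: val_inj; rewrite /= setI1g.
  by apply: homo_path sers => A B; apply: cyclic_factorI.
have -> : 1%G = (1 :&: X)%G :> {group gT} by apply: val_inj; rewrite /= setI1g.
by rewrite (last_map (fun K => (K :&: X)%G)) lasts; apply: val_inj; apply/setIidPr.
Qed.

Lemma cyclic_factor_quotient G N A B :
  G \subset 'N(N) -> B \subset G -> cyclic_factor G A B -> cyclic_factor (G / N) (A / N)
    (B / N).
Proof.
move=> nNG sBG /andP[/and3P[nAG nBG nsAB] cycBA].
rewrite /cyclic_factor /invariant_factor !quotient_norms //= quotient_normal //=.
have [x Bx defB] := cyclic_quotientP nsAB cycBA.
have nNB := subset_trans sBG nNG.
have nNA := subset_trans (normal_sub nsAB) nNB.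
have nsAB' : (A / N)%G <| (B / N)%G by apply: quotient_normal.
apply/(cyclic_quotientP nsAB'); exists (coset N x); first exact: mem_quotient.
by rewrite /= -defB quotientMl // quotient_cycle // (subsetP nNB).
Qed.

(** The terms of the series are intersected with [G] because those of a series
    from [1] to [G] are not assumed to lie in the normalizer of [N]. *)
Lemma supersolvable_quotient G N : G \subset 'N(N) -> supersolvable G -> supersolvable (G
  / N).
Proof.
move=> nNG [s sers lasts]; exists [seq ((K :&: G) / N)%G | K <- s].
  have -> : 1%G = ((1 :&: G) / N)%G :> {group coset_of N}.
    by apply: val_inj; rewrite /= setI1g quotient1.
  apply: homo_path sers => A B /(cyclic_factorI (subxx G)).
  by apply: cyclic_factor_quotient; rewrite ?subsetIr.
have -> : 1%G = ((1 :&: G) / N)%G :> {group coset_of N}.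
  by apply: val_inj; rewrite /= setI1g quotient1.
rewrite (last_map (fun K => ((K :&: G) / N)%G)) lasts.
by apply: val_inj; rewrite /= setIid.
Qed.

Lemma supersolvableJ G x : supersolvable G -> supersolvable (G :^ x).
Proof.
case=> s sers lasts; exists [seq (K :^ x)%G | K <- s].
  have -> : 1%G = (1 :^ x)%G :> {group gT} by apply: val_inj; rewrite /= conjs1g.
  apply: homo_path sers => A B /andP[/and3P[nAG nBG nsAB] cycBA].
  rewrite /= /cyclic_factor /invariant_factor !normJ !conjSg nAG nBG normalJ nsAB /=.
  have [y By defB] := cyclic_quotientP nsAB cycBA.
  have nsABx : (A :^ x)%G <| (B :^ x)%G by rewrite normalJ.
  apply/(cyclic_quotientP nsABx); exists (y ^ x); first by rewrite memJ_conjg.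
  by rewrite cycleJ -conjsMg defB.
have -> : 1%G = (1 :^ x)%G :> {group gT} by apply: val_inj; rewrite /= conjs1g.
by rewrite (last_map (fun K => (K :^ x)%G)) lasts.
Qed.

(** The first nontrivial term of the series is cyclic and normal, so its
    subgroups are normal too. *)
Lemma supersolvable_prime_normal G :
  supersolvable G -> G :!=: 1 -> exists2 N : {group gT}, N <| G & prime #|N|.
Proof.
case=> s; move def1: {1 2}1%G => U sers lasts ntG.
have: U :=: 1 by rewrite -def1.
elim: s U sers lasts {def1} => [|A s IHs] U /=; first by move=> _ -> /eqP;
  rewrite (negPf ntG).
case/andP=> /andP[/and3P[nUG nAG nsUA] cycA] sers lasts U1.
have [A1|ntA] := eqVneq (A : {set gT}) 1; first exact: IHs sers lasts A1.
have cA : cyclic A by rewrite (isog_cyclic (quotient1_isog A)) -U1.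
have sAG : A \subset G.
  rewrite -lasts; elim: s A sers {IHs nAG nsUA cycA ntA cA lasts} => //= B s IHs A.
  case/andP=> /andP[/and3P[_ _ /andP[sAB _]] _] /IHs; exact: subset_trans.
pose p := pdiv #|A|; have pr_p : prime p by rewrite pdiv_prime ?cardG_gt1.
have [x Ax ox] := Cauchy pr_p (pdiv_dvd _).
exists <[x]>%G; last by rewrite -[#|_|]/#[x] ox.
have chx : <[x]> \char A by rewrite (sub_cyclic_char _ cA) cycle_subG.
by rewrite /normal cycle_subG (subsetP sAG) // (char_norm_trans chx).
Qed.

End Supersolvable.

Definition primes_above n : nat_pred := [pred q | n < q].

(** This expresses the Sylow tower of a supersolvable group. Take [N] normal of
    prime order and, by induction, [X] with [X / N] the Hall subgroup of [G / N].
    If [#|N| <= n], a complement of [N] in [X] centralizes [N], because its order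
    has only prime divisors larger than [n] and so is prime to [#|N|.-1]; being a
    direct factor it is characteristic in [X]. *)
Lemma supersolvable_Hall_above (gT : finGroupType) (G : {group gT}) n :
  supersolvable G -> (primes_above n).-Hall(G) 'O_(primes_above n)(G).
Proof.
set pi := primes_above n; move: {2}_.+1 (ltnSn #|G|) => m.
elim: m gT G => // m IHm gT G; rewrite ltnS => leGm ssG.
have [G1|ntG] := eqVneq (G : {set gT}) 1.
  have -> : 'O_pi(G) = 1 by apply/trivgP; rewrite -G1 pcore_sub.
  by rewrite pHallE sub1G G1 !cards1 partn1.
have [N nsNG pr_N] := supersolvable_prime_normal ssG ntG.
have [sNG nNG] := andP nsNG.
have ntN : N :!=: 1 by rewrite -cardG_gt1 prime_gt1.
have: pi.-Hall(G / N) 'O_pi(G / N).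
  apply: (IHm _ (G / N)%G); last exact: supersolvable_quotient.
  exact: leq_trans (ltn_quotient ntN sNG) leGm.
set Xb := 'O_pi(_) => hallXb.
have [X defX sNX nsXG] := inv_quotientN nsNG (pcore_normal pi (G / N)).
have [sXG nXG] := andP nsXG.
have nsNX : N <| X := normalS sNX sXG nsNG.
have iGX : pi^'.-nat #|G : X|.
  have [_ _] := and3P hallXb; rewrite /Xb defX index_quotient_eq //.
  by rewrite subIset // sNX orbT.
have piXN : pi.-nat #|X : N|.
  by rewrite -card_quotient ?normal_norm // -defX; exact: pcore_pgroup.
suffices [Y hallY nsYX] : exists2 Y : {group gT}, pi.-Hall(X) Y & Y <| X.
  have nsYG : Y <| G.
    rewrite -(normal_Hall_pcore hallY nsYX).
    exact: char_normal_trans (pcore_char _ _) nsXG.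
  have hallYG : pi.-Hall(G) Y.
    have [sYX piY p'Y] := and3P hallY.
    by rewrite /pHall (normal_sub nsYG) piY -(Lagrange_index sXG sYX) pnatM iGX.
  by rewrite (normal_Hall_pcore hallYG nsYG).
have [lt_ns|le_sn] := ltnP n #|N|.
  exists X => //; rewrite /pHall subxx indexgg /pgroup -(Lagrange sNX) pnatM piXN andbT.
  by rewrite pnatE // inE lt_ns.
have pi'N : pi^'.-group N by rewrite /pgroup pnatE // !inE -leqNgt.
have hallN : Hall X N.
  by apply: (@pHall_Hall _ pi^'); rewrite /pHall sNX pi'N pnatNK.
have /splitsP[Y /complP[tiNY defNY]] := SchurZassenhaus_split hallN nsNX.
have oY : #|Y| = #|X : N| by rewrite -defNY indexMg -indexgI setIC tiNY indexg1.
have sYX : Y \subset X by rewrite -defNY mulG_subr.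
have nNX := normal_norm nsNX.
have piY : pi.-group Y by rewrite /pgroup oY.
have cNY : Y \subset 'C(N).
  apply: norm_prime_cent => //; last exact: subset_trans nNX.
  rewrite coprime_has_primes ?cardG_gt0 ?ltn_predRL ?prime_gt1 //.
  apply/hasPn => q; rewrite !mem_primes => /and3P[pr_q _ dq].
  rewrite pr_q cardG_gt0 /=; apply/negP=> dqY.
  have lt_nq : n < q := pgroupP piY q pr_q dqY.
  have := dvdn_leq _ dq; rewrite ltn_predRL prime_gt1 // => /(_ isT) leq_q.
  have := leq_trans lt_nq leq_q; rewrite ltnNge (leq_trans (leq_pred _)) //.
exists Y.
  rewrite /pHall sYX piY /=; apply: pnat_dvd pi'N.
  by rewrite -{1}defNY -(centC cNY) indexMg -indexgI dvdn_indexg.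
by rewrite /normal sYX -defNY mul_subG ?normG // cents_norm // centsC.
Qed.

Lemma supersolvable_sol (gT : finGroupType) (G : {group gT}) : supersolvable G ->
  solvable G.
Proof.
move: {2}_.+1 (ltnSn #|G|) => m; elim: m gT G => // m IHm gT G; rewrite ltnS => leGm ssG.
have [->|ntG] := eqVneq (G : {set gT}) 1; first exact: solvable1.
have [N nsNG pr_N] := supersolvable_prime_normal ssG ntG.
rewrite (series_sol nsNG) abelian_sol ?cyclic_abelian ?prime_cyclic //=.
apply: (IHm _ (G / N)%G); last by apply: supersolvable_quotient (normal_norm nsNG) ssG.
by apply: leq_trans leGm; rewrite ltn_quotient ?(normal_sub nsNG) // -cardG_gt1 prime_gt1.
Qed.

(** * Supplements of maximal subgroups of Sylow subgroups *)

(** The prime divisors of [#|H|] above [r.-1], for [r] the largest one, are just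
    [r]. *)
Lemma supersolvable_max_Sylow (gT : finGroupType) (H : {group gT}) :
    supersolvable H -> 
  exists2 R : {group gT}, R <| H & (max_pdiv #|H|).-Sylow(H) R.
Proof.
move=> ssH; set r := max_pdiv _.
exists [group of 'O_(primes_above r.-1)(H)]; first exact: pcore_normal.
have := supersolvable_Hall_above r.-1 ssH; rewrite (@eq_in_pHall _ _ r) //.
move=> q piHq; have r_gt0 : 0 < r by apply: max_pdiv_gt0.
rewrite !inE -ltnS (ltn_predK r_gt0) ltnS eqn_leq andbC.
by rewrite [q <= r]max_pdiv_max ?andbT.
Qed.

(** Hall subgroups with equal Sylow towers are conjugate: their normal Sylow
    subgroups for the largest prime are Sylow subgroups of [G], so they may be
    assumed equal to some [R], and induction applies in ['N_G(R) / R]. *)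
Lemma supersolvable_Hall_conj (gT : finGroupType) (pi : nat_pred) (G H K : {group gT}) :
    pi.-Hall(G) H -> pi.-Hall(G) K -> supersolvable H -> supersolvable K ->
  exists2 x, x \in G & K :=: H :^ x.
Proof.
have [n] := ubnP #|G|; elim: n gT G H K => // n IHn gT G H K; rewrite ltnS => leGn.
move=> hallH hallK ssH ssK.
have oHK : #|H| = #|K| by rewrite (card_Hall hallH) (card_Hall hallK).
have [H1|ntH] := eqVneq (H : {set gT}) 1.
  exists 1; rewrite ?group1 // conjsg1 H1; apply: card1_trivg.
  by rewrite -oHK H1 cards1.
have [R nsRH sylRH] := supersolvable_max_Sylow ssH.
have [R' nsRK sylRK] := supersolvable_max_Sylow ssK.
rewrite -oHK in sylRK; set r := max_pdiv _ in sylRH sylRK.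
have pr_r : prime r by rewrite max_pdiv_prime ?cardG_gt1.
have rH : r %| #|H| by apply: max_pdiv_dvd.
have pi_r : r \in pi by apply: (pgroupP (pHall_pgroup hallH)).
have sylR := subHall_Sylow hallH pi_r sylRH.
have sylR' := subHall_Sylow hallK pi_r sylRK.
have [x Gx defR'] := Sylow_trans sylR sylR'.
pose N := ('N_G(R'))%G.
have hallHx : pi.-Hall(G) (H :^ x)%G by rewrite pHallJ.
have sHxN : H :^ x \subset N.
  by rewrite subsetI (pHall_sub hallHx) defR' /= normJ conjSg normal_norm.
have sKN : K \subset N by rewrite subsetI (pHall_sub hallK) normal_norm.
have sNG : N \subset G := subsetIl _ _.
have nR'N : N \subset 'N(R') := subsetIr _ _.
have hallHx' : pi.-Hall(N / R') ((H :^ x) / R')%G.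
  by apply: quotient_pHall (subset_trans sHxN nR'N) (pHall_subl sHxN sNG hallHx).
have hallK' : pi.-Hall(N / R') (K / R')%G.
  by apply: quotient_pHall (subset_trans sKN nR'N) (pHall_subl sKN sNG hallK).
have ntR' : R' :!=: 1.
  by rewrite -cardG_gt1 (card_Hall sylRK) -oHK p_part_gt1 mem_primes pr_r rH cardG_gt0.
have sR'N : R' \subset N by rewrite subsetI (pHall_sub sylR') normG.
have ltNG : #|N / R'| < n.
  by apply: leq_trans leGn; apply: leq_trans (ltn_quotient ntR' sR'N) (subset_leq_card sNG).
have ssHx : supersolvable (H :^ x)%G.
  exact: supersolvableJ.
have [yb Nyb defKb] := IHn _ (N / R')%G _ _ ltNG hallHx' hallK'
  (supersolvable_quotient (subset_trans sHxN nR'N) ssHx)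
  (supersolvable_quotient (subset_trans sKN nR'N) ssK).
case/morphimP: Nyb defKb => y nRy Ny -> /= defKb.
exists (x * y); first by rewrite groupM // (subsetP sNG).
rewrite conjsgM; have nsRHxy : R' <| ((H :^ x) :^ y)%G.
  by rewrite /= -(normP nRy) normalJ defR' normalJ.
apply: quotient_inj nsRK nsRHxy _.
by rewrite /= quotientJ.
Qed.

Section Supplements.

Variables (gT : finGroupType) (S P : {group gT}) (p : nat).
Hypotheses (simS : simple S) (nabS : ~~ abelian S).
Hypotheses (def_p : p = pdiv #|S|) (sylP : p.-Sylow(S) P).
Implicit Types M T : {group gT}.

Let ntS : S :!=: 1. Proof. by case/simpleP: simS. Qed.
Let perfS : S^`(1) = S. Proof. exact: simple_perfect. Qed.
Let pr_p : prime p. Proof. by rewrite def_p pdiv_prime ?cardG_gt1. Qed.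
Let sPS : P \subset S := pHall_sub sylP.
Let pP : p.-group P := pHall_pgroup sylP.

(** As [p] is the smallest prime divisor of [#|S|], the p'-elements of a
    supersolvable supplement form a normal Hall subgroup of it. *)
Lemma supersolvable_supplement_p'Hall M T :
    M \subset P -> T \subset S -> M * T = S -> supersolvable T ->
  exists T2 : {group gT}, [/\ T2 <| T, p^'.-Hall(S) T2 & supersolvable T2].
Proof.
move=> sMP sTS defS ssT; pose T2 := 'O_(primes_above p)(T)%G.
have hallT2 := supersolvable_Hall_above p ssT.
have nsT2 : T2 <| T := pcore_normal _ _.
have sT2T := normal_sub nsT2.
exists T2; split=> //; last exact: supersolvableS sT2T ssT.
have [_ piT2 pi'T2] := and3P hallT2.
rewrite /pHall (subset_trans sT2T) //=; apply/andP; split.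
  by apply: sub_pgroup piT2 => q; rewrite !inE; apply: contraL => /eqP->; rewrite ltnn.
rewrite -(Lagrange_index sTS sT2T) pnatM; apply/andP; split.
  have cMT : commute M T by apply/comm_group_setP; rewrite defS groupP.
  have <- : T * M = S by rewrite -cMT.
  rewrite indexMg -indexgI pnatNK.
  exact: pnat_dvd (dvdn_indexg _ _) (pgroupS sMP pP).
apply/pnatP=> // q pr_q dq; rewrite !inE negbK.
have := pnatP _ (indexg_gt0 _ _) pi'T2 q pr_q dq; rewrite !inE -leqNgt => le_qp.
rewrite eqn_leq le_qp def_p pdiv_min_dvd ?prime_gt1 //.
exact: dvdn_trans dq (dvdn_trans (dvdn_indexg _ _) (cardSg sTS)).
Qed.

(** Suppose that every maximal subgroup of [P] has a supersolvable supplement, and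
    let [T] be a supersolvable p'-Hall subgroup of [S] such that [P] contains a
    Sylow [p]-subgroup of [B = 'N_S(T)]. By simplicity [B] is proper, so some
    maximal subgroup [M] of [P] contains [B :&: P]. A supplement of [M] has a
    normal Hall subgroup conjugate to [T], hence lies in a conjugate of [B], and
    [S = M * B]; then [P = M * (B :&: P) = M]. The double negation spares a
    decision procedure for the existence of supplements. *)
Lemma maximal_supersolvable_supplement :
  ~ (forall M, maximal M P -> ~ ~ has_supersolvable_supplement S M).
Proof.
move=> supP.
have ntP : P :!=: 1.
  by rewrite -cardG_gt1 (card_Hall sylP) p_part_gt1 mem_primes pr_p cardG_gt0 def_p
    pdiv_dvd.
have [P1|[M1 maxM1 _]] := maximal_exists (sub1G P).
  by rewrite -P1 eqxx in ntP.
apply: (supP M1 maxM1) => -[T1 [sT1S defS ssT1]].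
have sM1P := proper_sub (maxgroupp maxM1).
have [T0 [_ hallT0 ssT0]] := supersolvable_supplement_p'Hall sM1P sT1S defS ssT1.
have [PB0 sylPB0] := Sylow_exists p 'N_S(T0).
have sPB0 := subset_trans (pHall_sub sylPB0) (subsetIl _ _).
have [x Sx sPBP] := Sylow_Jsub sylP sPB0 (pHall_pgroup sylPB0).
pose T := (T0 :^ x)%G; pose B := 'N_S(T)%G; pose PB := (PB0 :^ x)%G.
have hallT : p^'.-Hall(S) T by rewrite pHallJ.
have ssT : supersolvable T by apply: supersolvableJ.
have sBS : B \subset S := subsetIl _ _.
have defB : 'N_S(T0) :^ x = B by rewrite conjIg (conjGid Sx) -normJ.
have sylPB : p.-Sylow(B) PB by rewrite -defB pHallJ2.
have neqBS : B :!=: S.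
  apply/eqP=> defBS; have nsTS : T <| S.
    by rewrite /normal (pHall_sub hallT) -{1}defBS subsetIr.
  have [_ simpS] := simpleP _ simS.
  have [T1_1|TS] := simpS T nsTS.
    case/negP: (perfect_not_pgroup p perfS ntS).
    by have [_ _] := and3P hallT; rewrite T1_1 indexg1 pnatNK.
  have [_ p'T _] := and3P hallT.
  have := pgroupP p'T p pr_p; rewrite TS def_p pdiv_dvd => /(_ isT).
  by rewrite !inE eqxx.
have neqPB : PB :!=: P.
  apply/eqP=> defPB; case/eqP: neqBS; apply/eqP; rewrite eqEsubset sBS /=.
  have defPT : P * T = S.
    apply: coprime_index_mulG; rewrite ?(pHall_sub hallT) //.
    rewrite coprime_sym; have [_ _ iP] := and3P sylP; have [_ _ iT] := and3P hallT.
    by apply: (pnat_coprime (pi := p)) iP; rewrite -pnatNK.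
  rewrite -{1}defPT mul_subG //; first by rewrite -defPB (pHall_sub sylPB).
  by rewrite subsetI (pHall_sub hallT) normG.
have [PBP|[M2 maxM2 sPBM]] := maximal_exists sPBP; first by rewrite -PBP eqxx in neqPB.
have sM2P := proper_sub (maxgroupp maxM2).
apply: (supP M2 maxM2) => -[T3 [sT3S defS3 ssT3]].
have [T4 [nsT4 hallT4 ssT4]] := supersolvable_supplement_p'Hall sM2P sT3S defS3 ssT3.
have [y Sy defT] := supersolvable_Hall_conj hallT4 hallT ssT4 ssT.
have defM2B : M2 * B = S.
  have sT3yB : T3 :^ y \subset B.
    rewrite subsetI -{1}(conjGid Sy) conjSg sT3S /= defT normJ conjSg.
    exact: normal_norm.
  have sM2S := subset_trans sM2P sPS.
  apply/eqP; rewrite eqEsubset mul_subG //=.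
  rewrite -{1}(mulG_conj_eq sM2S sT3S defS3 Sy); exact: mulgS.
have defP : M2 * (B :&: P) = P.
  by rewrite group_modl // defM2B; apply/setIidPr.
have sPBI : PB \subset B :&: P by rewrite subsetI (pHall_sub sylPB).
have defPBI : B :&: P = PB.
  apply: (sub_pHall (K := (B :&: P)%G) sylPB); rewrite ?subsetIl //.
  exact: pgroupS (subsetIr _ _) pP.
have /andP[_ /negP[]] := maxgroupp maxM2.
by rewrite -{1}defP defPBI mul_subG.
Qed.

End Supplements.

(** * Subgroups of small index *)

Section SmallIndex.

Variables (gT : finGroupType).
Implicit Types S T L G P : {group gT}.

(** The action of [S] on the cosets of [T] is faithful. *)
Lemma simple_dvdn_fact_index S T :
  simple S -> T \proper S -> #|S| %| (#|S : T|)`!.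
Proof.
case/simpleP=> ntS simS /andP[sTS nsST].
pose X := rcosets T S; pose f := restr_perm X \o actperm 'Rs.
have actX x : x \in S -> actperm 'Rs x \in 'N(X | 'P).
  move=> Sx; have := subsetP (actsRs_rcosets T S) x Sx.
  by move/astabsP=> actSx; apply/astabsP=> Y; rewrite /= apermE actpermE; exact: actSx.
have fM : {in S &, {morph f : x y / x * y}}.
  move=> x y Sx Sy; rewrite /f /= morphM ?inE // morphM ?actX //.
pose g := Morphism fM.
have injg : 'injm g.
  have nsK : 'ker g <| S := ker_normal g.
  have [-> //|KS] := simS ('ker g)%G nsK.
  case/negP: nsST; apply/subsetP=> x Sx.
  have : g x = 1 by apply: mker; rewrite KS.
  move/permP/(_ (T : {set gT})); rewrite /= /f /= perm1 restr_permE ?actX //; last first.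
    by rewrite -[T : {set gT}]mulg1 -rcosetE mem_orbit. 
  rewrite actpermE //= rcosetE => <-; exact: rcoset_refl.
rewrite -(card_injm injg) // -[#|S : T|]/#|X|; rewrite -(@perm.card_Sym _ X);
  rewrite cardSg //.
apply/subsetP=> _ /morphimP[x Sx _ ->]; rewrite inE.
exact: restr_perm_on.
Qed.

(** In the first case [#|S|] divides [p`!] and has no prime divisor below [p], so it
    is [p]; in the second it divides [24], and the theorem of Burnside on
    groups whose order has two prime divisors makes [S] solvable. *)
Lemma no_small_solvable_index S T p :
    simple S -> ~~ abelian S -> p = pdiv #|S| -> T \subset S -> solvable T ->
    #|S : T| %| p \/ p = 2 /\ #|S : T| %| 4 -> False.
Proof.
move=> simS nabS def_p sTS solT iT; have [ntS _] := simpleP _ simS.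
have perfS := simple_perfect simS nabS.
have nsolS : ~~ solvable S.
  apply: contra nabS => solS; have := simple_sol_prime solS simS.
  by move/prime_cyclic/cyclic_abelian.
have prT : T \proper S.
  rewrite properEneq sTS andbT; apply: contraNneq nsolS => eTS.
  by rewrite -[S](val_inj eTS).
have dvS := simple_dvdn_fact_index simS prT.
have pr_p : prime p by rewrite def_p pdiv_prime ?cardG_gt1.
case: iT => [|[p2 iT]].
  case/primeP: (pr_p) => _ dvp /dvp{dvp} /pred2P[/eqP|iT].
    by rewrite indexg_eq1; move/andP: prT => [_ /negPf->].
  rewrite iT in dvS; case/negP: nabS; apply: cyclic_abelian; apply: prime_cyclic.
  have co k : k < p -> coprime #|S| k`!.
    elim: k => [|k IHk] ltkp; first by rewrite coprimen1.
    rewrite factS coprimeMr IHk ?(ltnW ltkp) // andbT.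
    rewrite coprime_has_primes ?cardG_gt0 //; apply/hasPn=> q.
    rewrite !mem_primes => /and3P[pr_q _ dqk]; rewrite pr_q cardG_gt0 /=.
    apply/negP=> dqS; have := pdiv_min_dvd (prime_gt1 pr_q) dqS.
    by rewrite -def_p leqNgt (leq_ltn_trans (dvdn_leq _ dqk)).
  move: dvS; rewrite -(prednK (prime_gt0 pr_p)) factS Gauss_dvdl ?co ?prednK ?prime_gt0 //.
  case/primeP: (pr_p) => _ dv /dv /pred2P[S1|->] //.
  by rewrite -cardG_gt1 S1 in ntS.
have dv24 : #|S| %| 24.
  apply: dvdn_trans dvS _; have/dvdn_leq : #|S : T| %| 4 := iT.
  move=> /(_ isT); case: #|S : T| => [|[|[|[|[|k]]]]] //.
case/negP: nsolS; apply: Burnside_p_a_q_b.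
have : {subset primes #|S| <= [:: 2; 3]}.
  by move=> q; rewrite mem_primes => /and3P[pr_q _ dq];
     have := dvdn_trans dq dv24; rewrite -[24]/(2 ^ 3 * 3)%N Euclid_dvdM // Euclid_dvdX //;
     rewrite !dvdn_prime2 // !inE => /orP[/andP[->]|->]//; rewrite orbT.
by move/(uniq_leq_size (primes_uniq _)).
Qed.

End SmallIndex.

(** * Components and the layer *)

Section Components.

Variables (gT : finGroupType).
Implicit Types A B G H K L N P Y : {group gT}.

(** In this form quasisimplicity does not mention a quotient type, and is visibly
    invariant under conjugation. *)
Lemma quasisimpleP K :
  reflect [/\ K^`(1) = K, K :!=: 1 & forall N, N <| K -> N :=: K \/ N \subset 'Z(K)]
          (quasisimple K).
Proof.
have nZK : K \subset 'N('Z(K)) := normal_norm (center_normal K).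
apply: (iffP andP) => [[/eqP perfK /simpleP[ntQ simQ]]|[perfK ntK normK]].
  have ntK : K :!=: 1 by apply: contraNneq ntQ => K1;
    rewrite -subG1 quotient_sub1 // K1 sub1G.
  split=> // N nsNK; have sNK := normal_sub nsNK.
  have nZN := subset_trans sNK nZK.
  have [N1|NK] := simQ (N / 'Z(K))%G (quotient_normal _ nsNK).
    by right; rewrite -quotient_sub1 // [_ / _]N1.
  left; apply/eqP; rewrite eqEsubset sNK /= -{1}perfK.
  have defK : K :=: 'Z(K) * N.
    apply/eqP; rewrite eqEsubset mul_subG ?center_sub // andbT -quotientSK //.
    by rewrite /= in NK; rewrite NK.
  apply: der1_min; first exact: normal_norm.
  by rewrite {1}defK quotientMidr; apply: quotient_abelian; apply: center_abelian.
split; first by rewrite perfK.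
apply/simpleP; split.
  apply: contra ntK; rewrite -subG1 quotient_sub1 // => sKZ.
  have abK : abelian K by apply: abelianS sKZ (center_abelian K).
  by rewrite -perfK; apply/eqP/derG1P.
move=> Nb nsNb; have [N defN sZN nsNK] := inv_quotientN (center_normal K) nsNb.
have [NK|sNZ] := normK N nsNK; first by right; rewrite defN NK.
left; apply/trivgP; rewrite defN quotient_sub1 //.
exact: subset_trans sNZ (subset_trans (center_sub K) nZK).
Qed.

(** Put [A] and [K] in proper normal subgroups [A1] and [K1] of [G]. If [A1] does
    not contain [K], induction in [K1] shows that [K] centralizes [A1 :&: K1],
    which contains [[~: A1, K]]; the three subgroup lemma and [K^`(1) = K] give
    [[~: A1, K] = 1]. *)
Lemma component_subnormal G A K :
    A <|<| G -> K <|<| G -> quasisimple K -> K \subset A \/ A \subset 'C(K).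
Proof.
have [n] := ubnP #|G|; elim: n G A K => // n IHn G A K; rewrite ltnS => leGn.
move=> snA snK qK; have [perfK ntK normK] := quasisimpleP _ qK.
have sKG := subnormal_sub snK; have sAG := subnormal_sub snA.
have [->|[A1 [snAA1 nsA1 prA1]]] := subnormalEr snA; first by left.
have [defK|[K1 [snKK1 nsK1 prK1]]] := subnormalEr snK.
  have nsA1K : A1 <| K by rewrite defK.
  have [A1K|sA1Z] := normK A1 nsA1K.
    by rewrite A1K defK properxx in prA1.
  right; apply: subset_trans (subnormal_sub snAA1) (subset_trans sA1Z _).
  exact: subsetIr.
have sA1G := normal_sub nsA1; have sK1G := normal_sub nsK1.
have [sKA1|nsKA1] := boolP (K \subset A1).
  apply: (IHn A1) => //; first exact: leq_trans (proper_card prA1) leGn.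
  by have := setI_subnormal sA1G snK; rewrite (setIidPl sKA1).
right; apply: subset_trans (subnormal_sub snAA1) _.
have nsI : A1 :&: K1 <| K1 by rewrite setIC; apply: normalGI sK1G nsA1.
have [sKI|cIK] := IHn K1 (A1 :&: K1)%G K (leq_trans (proper_card prK1) leGn)
  (normal_subnormal nsI) snKK1 qK.
  by case/negP: nsKA1; apply: subset_trans sKI (subsetIl _ _).
have sKK1 := subnormal_sub snKK1.
have sRI : [~: A1, K] \subset A1 :&: K1.
  rewrite subsetI commg_subl (subset_trans sKG) ?normal_norm //=.
  apply: subset_trans (commgS _ sKK1) _.
  by rewrite commg_subr (subset_trans sA1G) ?normal_norm.
have R1 : [~: A1, K, K] = 1 by apply/commG1P/(subset_trans sRI).
apply/commG1P; rewrite commGC -{1}perfK.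
apply: three_subgroup => //; first by rewrite (commGC K A1).
Qed.

Lemma nilpotent_subnormal_Fitting H Y : Y <|<| H -> nilpotent Y -> Y \subset 'F(H).
Proof.
have [n] := ubnP #|H|; elim: n H => // n IHn H; rewrite ltnS => leHn snY nilY.
have [<-|[K [snYK nsKH prKH]]] := subnormalEr snY; first by rewrite nilpotent_Fitting.
apply: subset_trans (IHn K (leq_trans (proper_card prKH) leHn) snYK nilY) _.
apply: Fitting_max (Fitting_nil K); exact: char_normal_trans (Fitting_char K) nsKH.
Qed.

(** Bender's theorem on the generalized Fitting subgroup, when the layer is
    trivial. A minimal subnormal subgroup [Y] of [H] that centralizes ['F(H)]
    but is not contained in it has all its proper normal subgroups in
    ['F(H) :&: Y], which is central in [Y]; as [Y] is not nilpotent it is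
    quasisimple, hence contained in the layer. *)
Lemma cent_Fitting_layer1 H : layer H = 1 -> 'C_H('F(H)) \subset 'F(H).
Proof.
move=> layer1; apply/idPn=> nsCF.
pose gP := [pred Y : {group gT} | [&& Y <|<| H, Y \subset 'C('F(H)) & ~~ (Y \subset
  'F(H))]].
have exY : exists Y : {group gT}, gP Y.
  exists ('C_H('F(H)))%G; rewrite /= nsCF subsetIr normal_subnormal //.
  rewrite /normal subsetIl normsI ?normG ?norms_cent //.
  exact: normal_norm (Fitting_normal H).
have [Y /mingroupP[/and3P[snY cFY nsYF] minY]] := ex_mingroup exY.
have sYH := subnormal_sub snY.
have normY N : N <| Y -> N :=: Y \/ N \subset 'Z(Y).
  move=> nsNY; have sNY := normal_sub nsNY.
  have [sNF|nsNF] := boolP (N \subset 'F(H)).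
    by right; rewrite subsetI sNY; apply: subset_trans sNF _; rewrite centsC.
  left; apply: minY => //; apply/and3P; split=> //; last exact: subset_trans cFY.
  exact: subnormal_trans (normal_subnormal nsNY) snY.
have nnilY : ~~ nilpotent Y.
  by apply: contra nsYF; apply: nilpotent_subnormal_Fitting.
have perfY : Y^`(1) = Y.
  have [//|sY'Z] := normY (Y^`(1))%G (der_normal 1 Y).
  case/negP: nnilY; apply: small_nil_class; rewrite (leq_trans (_ : _ <= 2)) //.
  by rewrite nil_class2.
have ntY : Y :!=: 1 by apply: contraNneq nsYF => ->; apply: sub1G.
have qY : quasisimple Y by apply/quasisimpleP.
case/negP: ntY; rewrite -subG1 -layer1 sub_gen // (bigcup_max Y) //.
by rewrite snY.
Qed.


Lemma quasisimpleJ K x : quasisimple K -> quasisimple (K :^ x).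
Proof.
case/quasisimpleP=> perfK ntK normK; apply/(@quasisimpleP (K :^ x)%G); split.
- by rewrite /= derJ perfK.
- by rewrite -cardG_gt1 cardJg cardG_gt1.
move=> N nsNKx; have nsN : (N :^ x^-1)%G <| K by rewrite -(normalJ _ _ x) conjsgKV.
have [NK|sNZ] := normK _ nsN; [left | right]; first by rewrite /= -NK /= conjsgKV.
by rewrite /= /center centJ -conjIg -sub_conjgV.
Qed.

Lemma subnormalJ H K x : K <|<| H -> K :^ x <|<| H :^ x.
Proof.
case/subnormalP=> s sers lasts; apply/(@subnormalP _ (K :^ x)%G (H :^ x)%G).
exists [seq (L :^ x)%G | L <- s]; last by rewrite (last_map (fun L => (L :^ x)%G)) lasts.
by apply: homo_path sers => A B; rewrite /= normalJ.
Qed.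

Lemma layer_sub H : layer H \subset H.
Proof. by rewrite gen_subG; apply/bigcupsP=> K /andP[/subnormal_sub]. Qed.

Lemma layer_norm G H : G \subset 'N(H) -> G \subset 'N(layer H).
Proof.
move=> nHG; apply/subsetP=> x Gx; rewrite inE -genJ gen_subG.
apply/subsetP=> _ /imsetP[y /bigcupP[K /andP[snK qK] Ky] ->].
apply: mem_gen; apply/bigcupP; exists (K :^ x)%G; last by rewrite memJ_conjg.
rewrite quasisimpleJ // andbT /= -(normP (subsetP nHG x Gx)).
exact: subnormalJ.
Qed.

Lemma generalized_Fitting_normal G H : H <| G -> generalized_Fitting H <| G.
Proof.
case/andP=> sHG nHG; have sEH : generalized_Fitting H \subset H.
  by rewrite join_subG Fitting_sub layer_sub.
rewrite /normal (subset_trans sEH) //= normsY ?layer_norm //.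
exact: char_norm_trans (Fitting_char H) nHG.
Qed.

Section OneComponent.

Variables (H K : {group gT}).
Hypotheses (snK : K <|<| H) (qK : quasisimple K).
Local Notation E := (generalized_Fitting H).

Let perfK : K^`(1) = K. Proof. by case/quasisimpleP: qK. Qed.
Let ntK : K :!=: 1. Proof. by case/quasisimpleP: qK. Qed.

(** These facts exhibit [E / 'C_E(K)] as a nonabelian simple quotient of [E]. *)
Lemma component_sub_gFitting : K \subset E.
Proof.
apply: subset_trans (joing_subr _ _).
by rewrite sub_gen // (bigcup_max K) // snK.
Qed.

(** [component_subnormal] applied to ['F(H)] and to the other components. *)
Lemma gFitting_component : 'C_E(K) * K = E.
Proof.
have sKE := component_sub_gFitting.
have nCK : K \subset 'N('C_E(K)) by rewrite normsI ?norms_cent ?normG // (subset_trans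
  sKE) ?normG.
apply/eqP; rewrite eqEsubset mul_subG ?subsetIl //= -norm_joinEr //.
have cent_sub A : A <|<| H -> A \subset E -> (K \subset A -> A \subset K) -> A \subset
  'C_E(K) <*> K.
  move=> snA sAE eqKA; have [sKA|cAK] := component_subnormal snA snK qK.
    exact: subset_trans (eqKA sKA) (joing_subr _ _).
  by apply: subset_trans (joing_subl _ _); rewrite subsetI sAE.
rewrite join_subG; apply/andP; split.
  apply: (cent_sub ('F(H))%G); first exact: normal_subnormal (Fitting_normal H).
    exact: joing_subl.
  move=> sKF; case/negP: ntK; apply/eqP/perfect_nil_trivial => //.
  exact: nilpotentS sKF (Fitting_nil H).
rewrite gen_subG; apply/bigcupsP=> L /andP[snL qL].
apply: cent_sub => // [|sKL]; first by apply: subset_trans (joing_subr _ _);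
  rewrite sub_gen // (bigcup_max L) // snL.
have := setI_subnormal (subnormal_sub snL) snK; rewrite (setIidPl sKL) => snKL.
have [-> //|[M [snKM nsML prML]]] := subnormalEr snKL.
have [_ _ normL] := quasisimpleP _ qL.
have [ML|sMZ] := normL M nsML; first by rewrite ML properxx in prML.
case/negP: ntK; apply/eqP; rewrite -perfK; apply/derG1P.
apply: abelianS (center_abelian L); exact: subset_trans (subnormal_sub snKM) sMZ.
Qed.

Lemma component_normal : K <| E.
Proof.
rewrite /normal component_sub_gFitting -{1}gFitting_component mul_subG ?normG //.
by apply: cents_norm; rewrite subsetIr.
Qed.

Lemma component_cent_normal : 'C_E(K) <| E.
Proof.
rewrite /normal subsetIl normsI ?normG //.
exact: norms_cent (normal_norm component_normal).
Qed.

Lemma component_TI_center : 'C_E(K) :&: K = 'Z(K).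
Proof. by rewrite setIC setICA (setIidPr (subset_trans (subsetIl _ _)
  component_sub_gFitting)). Qed.

Lemma component_quotient_isog : K / 'Z(K) \isog E / 'C_E(K).
Proof.
have nCK := subset_trans component_sub_gFitting (normal_norm component_cent_normal).
have defQ := quotientMidl 'C_E(K)%G K; rewrite gFitting_component in defQ.
by rewrite defQ -component_TI_center; apply: second_isog.
Qed.

Lemma component_quotient_simple : simple (E / 'C_E(K)).
Proof. by rewrite -(isog_simple component_quotient_isog); case/andP: qK. Qed.

Lemma component_quotient_nonabelian : ~~ abelian (E / 'C_E(K)).
Proof.
rewrite -(isog_abelian component_quotient_isog).
have nZK := normal_norm (center_normal K).
apply/negP=> abQ; have sK'Z := der1_min nZK abQ.
case/negP: ntK; rewrite -perfK; apply/eqP/derG1P; rewrite -perfK.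
exact: abelianS sK'Z (center_abelian K).
Qed.

End OneComponent.

End Components.

(** * Vanishing of the layer *)

Definition maximal_condition (gT : finGroupType) (G P : {group gT}) : Prop :=
  forall M : {group gT},
    maximal M P -> ~ has_supersolvable_supplement G M -> triangle G M.

Definition small_condition (gT : finGroupType) (G : {group gT}) (p : nat) (P : {group
  gT}) : Prop :=
  forall L : {group gT}, L \subset P -> cyclic L ->
    prime #|L| \/ [/\ #|L| = 4, p = 2, ~~ abelian P & ~~ (L \subset hypercenter G)] ->
    ~ has_supersolvable_supplement G L -> triangle G L.

Section TrivialLayer.

Variable gT : finGroupType.
Implicit Types A B C D E G H K L M N P Q R S T U : {group gT}.

(** Otherwise a p'-subgroup normalizing a [p]-subgroup [U] of [K] centralizes the
    elements of [U] of order [p] and [4], hence [U] by [coprime_cent_small], and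
    [Frobenius_perfect] applies. *)
Lemma exists_small_noncentral K P p :
    prime p -> K^`(1) = K -> p %| #|K| -> p.-Sylow(K) P ->
  exists2 x, x \in P & small_order p P x && (x \notin 'Z(K)).
Proof.
move=> pr_p perfK pK sylP; apply/exists_inP; apply: contraLR pK => /exists_inPn centP.
rewrite -p'natE // -/(pgroup _ _).
apply: Frobenius_perfect => // U sUK pU.
apply/p_residualP=> Q sylQ p'Q.
have sQN : Q \subset 'N_K(U) by case/and3P: sylQ => _ ->.
have /subsetIP[sQK nUQ] := sQN.
have [g Kg sUgP] := Sylow_Jsub sylP sUK pU.
apply: (coprime_cent_small pr_p pU p'Q nUQ) => x Ux sx.
have Pxg : x ^ g \in P by rewrite (subsetP sUgP) ?memJ_conjg.
have Zxg : x ^ g \in 'Z(K).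
  have := centP _ Pxg; rewrite negb_and negbK => /orP[/negP[]|//].
  move: sx; rewrite /small_order orderJ => /orP[->//|/and3P[-> -> nab]].
  rewrite (contra _ nab) ?orbT // => abP.
  by rewrite -(abelianJ U g); apply: abelianS sUgP abP.
have Zx : x \in 'Z(K).
  by rewrite -(memJ_norm x (subsetP (normal_norm (center_normal K)) g Kg)).
by apply: subsetP Zx; rewrite subIset // centS ?orbT.
Qed.

Lemma supplement_quotient G E C L T :
    E <| G -> C <| E -> L \subset E -> T \subset G -> L * T = G ->
  (L / C) * ((T :&: E) / C) = E / C.
Proof.
move=> nsEG nsCE sLE sTG defG.
have nCL := subset_trans sLE (normal_norm nsCE).
by rewrite -quotientMl // group_modl // defG (setIidPr (normal_sub nsEG)).
Qed.

(** The image of ['Z_n(G) :&: E] in the perfect group [E / C] is trivial by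
    induction: if it were everything, it would be a commutator group contained in
    the image of the previous term. *)
Lemma ucn_perfect_sub G E C n :
    E <| G -> C <| E -> simple (E / C) -> ~~ abelian (E / C) -> 'Z_n(G) :&: E \subset C.
Proof.
move=> nsEG nsCE simS nabS; have nCE := normal_norm nsCE.
have nsZE m : 'Z_m(G) :&: E <| E.
  by rewrite setIC; apply: normalGI (normal_sub nsEG) (ucn_normal _ _).
elim: n => [|n IHn]; first by rewrite ucn0 subIset ?sub1G.
have [|ZS] := simple_quotient_normal simS (nsZE n.+1).
  by apply: (quotient1_sub nsCE (A := ('Z_n.+1(G) :&: E)%G)); apply: subsetIr.
have [ntS _] := simpleP _ simS; case/eqP: ntS; apply/trivgP.
have perfS := simple_perfect simS nabS; rewrite /= in ZS perfS *.
rewrite -perfS derg1 -{1}ZS -quotientR //; last first.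
  exact: subset_trans (subsetIr _ _) nCE.
rewrite quotient_sub1;
  last by rewrite (subset_trans _ nCE) // commg_subr (subset_trans (subsetIr _ _)) ?normG.
apply: subset_trans IHn;
  rewrite subsetI commg_subr (subset_trans (subsetIr _ _) (normG E)) andbT.
apply: subset_trans (ucn_comm n G); apply: commgSS; first exact: subsetIl.
exact: normal_sub.
Qed.

(** Case (i) of the hypothesis fails on nonabelian simple quotients of normal
    subgroups. A maximal subgroup of [P / C] is the image of a maximal subgroup of
    [P] containing [P :&: C]; by [maximal_not_triangle] the latter has a
    supersolvable supplement, which [maximal_supersolvable_supplement] forbids. *)
Lemma not_maximal_condition G E C P p :
    E <| G -> C <| E -> simple (E / C) -> ~~ abelian (E / C) ->
    p = pdiv #|E / C| -> p.-Sylow(E) P ->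
  ~ maximal_condition G P.
Proof.
move=> nsEG nsCE simS nabS def_p sylP maxP.
have nCE := normal_norm nsCE; have [sPE pP _] := and3P sylP.
have ntS : E / C != 1 by case/simpleP: simS.
have pr_p : prime p by rewrite def_p pdiv_prime ?cardG_gt1.
have pdS : p %| #|E / C| by rewrite def_p pdiv_dvd.
have nCP := subset_trans sPE nCE.
have sylPC : p.-Sylow(E / C) (P / C)%G by apply: quotient_pHall.
apply: (maximal_supersolvable_supplement simS nabS def_p sylPC) => Mb maxMb nsuppMb.
pose f := restrm_morphism nCP (coset_morphism C).
have fP : f @* P = P / C by rewrite morphim_restrm setIid.
have sMbP : Mb \subset f @* P by rewrite fP (proper_sub (maxgroupp maxMb)).
pose M := (f @*^-1 Mb)%G.
have fM : f @* M = Mb by apply: morphpreK.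
have maxM : maximal M P.
  have : maximal Mb (f @* P)%G by rewrite /= fP.
  rewrite -(morphpre_maximal sMbP (subxx _)) /= morphimGK //.
  exact: subsetIl.
have sMP := proper_sub (maxgroupp maxM).
have defM : M / C = Mb by rewrite -fM morphim_restrm (setIidPr sMP).
apply: (maximal_not_triangle nsEG nsCE simS nabS pr_p pdS def_p sylP maxM).
  apply/subsetP=> x /setIP[Px Cx]; rewrite inE Px /= inE.
  by rewrite /= /restrm coset_id ?group1.
apply: maxP => // -[T [sTG defG ssT]]; apply: nsuppMb.
exists ((T :&: E) / C)%G; split; first by rewrite quotientS ?subsetIr.
  by rewrite -defM; apply: supplement_quotient sTG defG; rewrite ?(subset_trans sMP).
apply: supersolvable_quotient; first exact: subset_trans (subsetIr _ _) nCE.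
exact: supersolvableS (subsetIl _ _) ssT.
Qed.

(** Case (ii) fails for the generalized Fitting subgroup when there is a component
    [K]. By [exists_small_noncentral] some [x] of order [p] or [4] in [K :&: P] is
    not in ['Z(K)], so that [L = <[x]>] is not in [C]. A supersolvable
    supplement would give a solvable subgroup of index dividing [p] or [4] in
    [E / C]. If [L] satisfies the embedding condition, [triangle_cases] provides
    a normal subgroup [N] covering [E / C] with [L :&: N <= C], but such an [N]
    contains [K] and thereby [L]. *)
Lemma not_small_condition G H K P p :
    H <| G -> K <|<| H -> quasisimple K ->
    let E := generalized_Fitting_group H in let C := ('C_E(K))%G in
    p = pdiv #|E / C| -> p.-Sylow(E) P ->
  ~ small_condition G p P.
Proof.
move=> nsHG snK qK E C def_p sylP smallP.
have [perfK ntK normK] := quasisimpleP _ qK.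
have nsEG : E <| G := generalized_Fitting_normal nsHG.
have nsCE : C <| E := component_cent_normal snK qK.
have nsKE : K <| E := component_normal snK qK.
have [sKE nKE] := andP nsKE; have nCE := normal_norm nsCE; have sEG := normal_sub nsEG.
have simS : simple (E / C) := component_quotient_simple snK qK.
have nabS : ~~ abelian (E / C) := component_quotient_nonabelian snK qK.
have perfS : (E / C)^`(1) = E / C := simple_perfect simS nabS.
have ntS : E / C != 1 by case/simpleP: simS.
have pr_p : prime p by rewrite def_p pdiv_prime ?cardG_gt1.
have pdS : p %| #|E / C| by rewrite def_p pdiv_dvd.
have [sPE pP _] := and3P sylP.
have sylPK : p.-Sylow(K) (K :&: P)%G := Sylow_setI_normal nsKE sylP.
have pK : p %| #|K|.
  apply: dvdn_trans pdS _; rewrite -(card_isog (component_quotient_isog snK qK)).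
  exact: dvdn_quotient.
have [x /setIP[Kx Px] /andP[small_x nZx]] := exists_small_noncentral pr_p perfK pK sylPK.
pose L := <[x]>%G.
have sLP : L \subset P by rewrite cycle_subG.
have sLE := subset_trans sLP sPE; have pL := pgroupS sLP pP.
have sLK : L \subset K by rewrite cycle_subG.
have nsLC : ~~ (L \subset C).
  rewrite cycle_subG; apply: contra nZx => Cx.
  by rewrite -(component_TI_center snK qK) inE Kx Cx.
have ox : #[x] = p \/ [/\ #[x] = 4, p = 2 & ~~ abelian P].
  move: small_x; rewrite /small_order => /orP[/eqP|/and3P[/eqP ox /eqP p2 nab]];
    [by left|right].
  by split=> //; apply: contra nab; apply: abelianS (subsetIr _ _).
have triL : triangle G L.
  apply: (smallP L sLP (cycle_cyclic x)) => [|[T [sTG defG ssT]]].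
    case: ox => [ox|[ox p2 nab]]; [by left; rewrite -orderE ox | right].
    split=> //; apply: contra nsLC => sLZ.
    have sZC : 'Z_(#|G|)(G) :&: E \subset C by apply: ucn_perfect_sub.
    by apply: subset_trans sZC; rewrite subsetI sLZ.
  have defS := supplement_quotient nsEG nsCE sLE sTG defG.
  pose Tb := ((T :&: E) / C)%G.
  have sTbS : Tb \subset E / C by rewrite quotientS ?subsetIr.
  apply: (@no_small_solvable_index _ (E / C)%G Tb p) => //.
    apply: quotient_sol; exact: solvableS (subsetIl _ _) (supersolvable_sol ssT).
  have dvi : #|E / C : Tb| %| #[x].
    have cLT : commute (L / C)%G Tb by apply/comm_group_setP; rewrite defS groupP.
    rewrite -defS /= cLT indexMg -indexgI.
    apply: dvdn_trans (dvdn_indexg _ _) _; exact: dvdn_quotient.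
  by case: ox => [<-|[<- p2 _]]; [left | right].
have nsylL : ~~ p.-Sylow(E / C) (L / C)%G.
  apply/negP=> sylL; have /negP[] := perfect_Sylow_pdiv_noncyclic perfS ntS def_p sylL.
  exact: quotient_cyclic (cycle_cyclic x).
have [N [nsNG sLNC] [sLC|NS]] := triangle_cases nsEG nsCE simS nabS pr_p pdS triL sLE pL
  nsylL.
  by rewrite sLC in nsLC.
have nsNE : N :&: E <| E by rewrite setIC; apply: normalGI sEG nsNG.
have sKN : K \subset N.
  have nsNK : N :&: K <| K.
    by rewrite setIC; apply: normalGI (subset_trans sKE sEG) nsNG.
  have [<-|sNZ] := normK (N :&: K)%G nsNK; first exact: subsetIl.
  case/eqP: ntS; rewrite -NS; apply/trivgP.
  rewrite quotient_sub1; last exact: subset_trans (subsetIr _ _) nCE.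
  rewrite subsetI subsetIr /=.
  have sRI : [~: N :&: E, K] \subset N :&: K.
    rewrite subsetI commg_subr (subset_trans (subsetIr _ _) nKE) andbT.
    apply: subset_trans (commSg _ (subsetIl _ _)) _.
    by rewrite commg_subl (subset_trans _ (normal_norm nsNG)) // (subset_trans sKE).
  have R1 : [~: N :&: E, K, K] = 1.
    apply/commG1P; apply: subset_trans sRI (subset_trans sNZ _); exact: subsetIr.
  apply/commG1P; rewrite commGC -{1}perfK.
  by apply: three_subgroup => //; first by rewrite (commGC K).
case/negP: nsLC; apply: subset_trans sLNC; rewrite subsetI subxx.
exact: subset_trans sLK sKN.
Qed.

(** A component [K] would make [E / 'C_E(K)], with [E] the generalized Fitting
    subgroup, a nonabelian simple quotient; both alternatives fail for the
    smallest prime divisor of its order, for which Sylow subgroups are not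
    cyclic. *)
Lemma layer_trivial G H :
    H <| G ->
    (forall p P, prime p -> p.-Sylow(generalized_Fitting H) P -> ~~ cyclic P ->
       maximal_condition G P \/ small_condition G p P) ->
  layer H = 1.
Proof.
move=> nsHG condG.
have [/existsP[K /andP[snK qK]]|/existsPn noK] :=
  boolP [exists K : {group gT}, (K <|<| H) && quasisimple K]; last first.
  apply/trivgP; rewrite gen_subG; apply/bigcupsP=> K snqK.
  by move: (noK K); rewrite snqK.
exfalso; pose E := generalized_Fitting_group H; pose C := ('C_E(K))%G.
have nsCE : C <| E := component_cent_normal snK qK.
have simS : simple (E / C) := component_quotient_simple snK qK.
have nabS : ~~ abelian (E / C) := component_quotient_nonabelian snK qK.
pose p := pdiv #|E / C|; have def_p : p = pdiv #|E / C| by [].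
have pr_p : prime p by rewrite pdiv_prime ?cardG_gt1; case/simpleP: simS.
have [P sylP] := Sylow_exists p E.
have ncycP : ~~ cyclic P.
  apply: contra (Sylow_quotient_noncyclic nsCE simS nabS def_p sylP).
  exact: quotient_cyclic.
have [maxP|smallP] := condG p P pr_p sylP ncycP.
  exact: not_maximal_condition (generalized_Fitting_normal nsHG) nsCE simS nabS def_p
    sylP maxP.
exact: not_small_condition nsHG snK qK def_p sylP smallP.
Qed.

End TrivialLayer.

(** * Hypercyclically embedded p-subgroups *)

(** The smallest normal subgroup of [A] with abelian quotient of exponent dividing
    [p.-1]. *)
Definition expg_residual (gT : finGroupType) (p : nat) (A : {set gT}) : {set gT} :=
  A^`(1) <*> <<[set x ^+ p.-1 | x in A]>>.

Canonical expg_residual_group gT p A := [group of @expg_residual gT p A].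

Section ExpgResidual.

Variable p : nat.
Hypothesis pr_p : prime p.

Lemma expg_residualP (gT : finGroupType) (G M : {group gT}) :
  reflect (G^`(1) \subset M /\ {in G, forall x, x ^+ p.-1 \in M})
          (expg_residual p G \subset M).
Proof.
rewrite join_subG (gen_subG [set x ^+ p.-1 | x in G]); apply: (iffP andP) => -[sG'M sXM];
  split=> //.
  by move=> x Gx; apply: (subsetP sXM); apply/imsetP; exists x.
by apply/subsetP=> _ /imsetP[x Gx ->]; apply: sXM.
Qed.

Lemma expg_residual_normal (gT : finGroupType) (G : {group gT}) : expg_residual p G <| G.
Proof.
apply: sub_der1_normal; first exact: joing_subl.
by apply/expg_residualP; split=> [|x Gx]; rewrite ?der_sub ?groupX.
Qed.

(** [Aut X] is abelian of order [p.-1]. *)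
Lemma expg_residual_prime_cent (gT : finGroupType) (D X : {group gT}) :
  #|X| = p -> D \subset 'N(X) -> expg_residual p D \subset 'C(X).
Proof.
move=> oX nXD; have cycX : cyclic X by apply: prime_cyclic; rewrite oX.
have sAut : conj_aut X @* D \subset Aut X.
  by apply/subsetP=> _ /morphimP[x _ _ ->]; exact: Aut_aut.
have oAut : #|Aut X| = p.-1.
  have [x defX] := cyclicP cycX.
  by rewrite {1}defX card_Aut_cycle orderE -defX oX totient_prime.
have abD : abelian (conj_aut X @* D) := abelianS sAut (Aut_cyclic_abelian cycX).
apply/expg_residualP; split=> [|x Dx].
  rewrite /= -(ker_conj_aut X) ker_trivg_morphim (subset_trans (der_sub 1 D)) //=.
  by rewrite morphim_der // (derG1P abD) subxx.
rewrite /= -(ker_conj_aut X); have nx := subsetP nXD x Dx.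
apply/kerP; rewrite ?groupX // morphX // -oAut.
by apply: expg_cardG; apply: (subsetP sAut); apply: mem_morphim.
Qed.

Lemma comm_expg_residual (gT : finGroupType) (G A B : {group gT}) :
    A <| G -> B <| G -> B \subset A -> #|A / B| %| p ->
  [~: A, expg_residual p G] \subset B.
Proof.
move=> /andP[sAG nAG] /andP[sBG nBG] sBA dp.
have nBA := subset_trans sAG nBG.
have sRG := normal_sub (expg_residual_normal G); have nBR := subset_trans sRG nBG.
case/primeP: (pr_p) => _ /(_ _ dp) /pred2P[A1|oA].
  have sAB : A \subset B by rewrite -quotient_sub1 // (card1_trivg A1).
  by apply: subset_trans (commSg _ sAB) _; rewrite commg_subl.
rewrite commGC -quotient_cents2 // sub_quotient_pre //.
have cR : expg_residual p (G / B) \subset 'C(A / B).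
  by apply: (@expg_residual_prime_cent _ (G / B)%G (A / B)%G); rewrite ?quotient_norms.
have /(@expg_residualP _ (G / B)%G 'C(A / B)%G)[sG'C sXC] := cR.
apply/expg_residualP; split=> [|x Gx].
  by rewrite -sub_quotient_pre ?(subset_trans (der_sub 1 G)) // quotient_der.
have nx := subsetP nBG x Gx.
apply/morphpreP; split; first exact: groupX.
by rewrite morphX //; apply: sXC; apply: mem_quotient.
Qed.

Section Action.

Variables (gT : finGroupType) (G P : {group gT}).
Hypotheses (nsPG : P <| G) (pP : p.-group P).
Implicit Types A B K L M N Q T U V W : {group gT}.

(** A normal [p]-subgroup of [G] is hypercyclically embedded, that is, all chief
    factors of [G] below it are cyclic, exactly when it is centralized by this
    subgroup. Factors of order [p] are centralized by [comm_hcyc_prime], and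
    [comm_hcyc_trans] climbs along a series; [chief_factor_prime] is the
    converse. *)
Definition hcyc_residual : {set gT} := p_residual p (expg_residual p G).
Canonical hcyc_residual_group := [group of hcyc_residual].
Local Notation R := (expg_residual p G).
Local Notation Y := hcyc_residual.

Let sPG := normal_sub nsPG.
Let nPG := normal_norm nsPG.
Let sRG : R \subset G := normal_sub (expg_residual_normal G).
Let sYR : Y \subset R := p_residual_sub _ _.

Lemma hcyc_residual_normal : Y <| G.
Proof.
rewrite /normal (subset_trans sYR sRG).
by rewrite p_residual_norm // normal_norm // expg_residual_normal.
Qed.

Lemma comm_hcyc_trans A U W :
    A <| G -> A \subset P -> U <| G -> W <| G -> U \subset A -> W \subset U ->
    [~: A, Y] \subset U -> [~: U, Y] \subset W ->
  [~: A, Y] \subset W.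
Proof.
move=> nsAG sAP nsUG nsWG sUA sWU;
  have nR N (nsNG : N <| G) := subset_trans sRG (normal_norm nsNG).
have sAG := normal_sub nsAG.
apply: comm_p_residual_trans; rewrite ?nR ?(pgroupS sAP) //; first exact: normalS nsUG.
exact: normalS (subset_trans sWU sUA) sAG nsWG.
Qed.

Lemma comm_hcyc_prime A B :
  A <| G -> B <| G -> B \subset A -> #|A / B| %| p -> [~: A, Y] \subset B.
Proof.
move=> nsAG nsBG sBA dp; apply: subset_trans (commgS _ sYR) _.
exact: comm_expg_residual.
Qed.

Let nsPhiG : 'Phi(P) <| G := char_normal_trans (Phi_char P) nsPG.

(** [P] acts trivially on [P / 'Phi(P)]. *)
Lemma supplement_norm_sub T A :
  P * T = G -> 'Phi(P) \subset A -> A \subset P -> T \subset 'N(A) -> A <| G.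
Proof.
move=> defG sPhiA sAP nAT; rewrite /normal (subset_trans sAP) //= -defG mul_subG //.
apply: sub_der1_norm sAP; apply: subset_trans sPhiA.
by rewrite (Phi_joing pP) joing_subl.
Qed.

(** A series of [T] with cyclic factors, intersected with [P] and multiplied by
    ['Phi(P)], is a series of normal subgroups of [G] whose factors are cyclic of
    exponent dividing [p]. *)
Lemma comm_hcyc_supplement T :
  supersolvable T -> T \subset G -> P * T = G -> [~: P :&: T, Y] \subset 'Phi(P).
Proof.
case=> s sers lasts sTG defG; pose X := (P :&: T)%G.
have sXP : X \subset P := subsetIl _ _; have sXT : X \subset T := subsetIr _ _.
have nPhiG := normal_norm nsPhiG.
have nXT : T \subset 'N(X) by rewrite normsI ?normG ?(subset_trans sTG).
have -> : P :&: T = last 1%G s :&: X by rewrite lasts; apply/esym/setIidPr.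
have : [~: 1%G :&: X, Y] \subset 'Phi(P) by rewrite setI1g comm1G sub1G.
elim: s 1%G sers {lasts} => //= V s IHs U /andP[cfUV sers] sUY; apply: IHs sers _.
have [/and3P[nUT nVT nsUV] _] := andP cfUV.
have /andP[/and3P[_ _ nsUVX] cycUVX] := cyclic_factorI sXT cfUV.
have [x VXx defVX] := cyclic_quotientP nsUVX cycUVX.
pose A := ((V :&: X) <*> 'Phi(P))%G; pose B := ((U :&: X) <*> 'Phi(P))%G.
have sVXP : V :&: X \subset P by rewrite subIset // sXP orbT.
have sUXP : U :&: X \subset P by rewrite subIset // sXP orbT.
have sAP : A \subset P by rewrite join_subG sVXP Phi_sub.
have sBP : B \subset P by rewrite join_subG sUXP Phi_sub.
have nsAG : A <| G.
  apply: (supplement_norm_sub defG) => //; first exact: joing_subr.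
  by rewrite normsY ?normsI // (subset_trans sTG).
have nsBG : B <| G.
  apply: (supplement_norm_sub defG) => //; first exact: joing_subr.
  by rewrite normsY ?normsI // (subset_trans sTG).
have sBA : B \subset A by rewrite genS // setSU // setSI // normal_sub.
have sPhiB : 'Phi(P) \subset B := joing_subr _ _.
apply: subset_trans (commSg _ (joing_subl _ 'Phi(P))) _.
apply: (@comm_hcyc_trans A B ('Phi(P))%G) => //.
  apply: comm_hcyc_prime => //.
  have nBA := subset_trans (normal_sub nsAG) (normal_norm nsBG).
  have Ax : x \in A by rewrite mem_gen // inE VXx.
  have nBx := subsetP nBA x Ax.
  have -> : A / B = <[coset B x]>.
    have defVX' : (U :&: X) * <[x]> = V :&: X := defVX.
    have defVXB : (V :&: X) / B = <[coset B x]>.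
      rewrite -{1}defVX' quotientMl; last first.
        exact: subset_trans (joing_subl _ _) (normG B).
      by rewrite (quotientS1 (joing_subl _ _)) mul1g quotient_cycle.
    rewrite quotientY ?(subset_trans _ nBA) ?joing_subl ?joing_subr //.
    by rewrite (quotientS1 sPhiB) joingG1.
  rewrite -orderE order_dvdn -morphX //; apply/eqP/coset_id/(subsetP sPhiB).
  by apply: abelem_Phi_expg => //; apply: (subsetP sAP).
have nPhiY : Y \subset 'N('Phi(P)) := subset_trans sYR (subset_trans sRG nPhiG).
have nPhiP := subset_trans sPG nPhiG.
rewrite commGC -quotient_cents2 ?(subset_trans sBP) // quotientYidr ?(subset_trans sUXP) //.
by rewrite quotient_cents2 ?(subset_trans sUXP) // commGC.
Qed.

End Action.
End ExpgResidual.

(** * Embedding conditions below a normal p-subgroup *)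

Section NormalPSubgroup.

Variables (gT : finGroupType) (p : nat) (G P : {group gT}).
Hypotheses (pr_p : prime p) (nsPG : P <| G) (pP : p.-group P).
Implicit Types A B K L M N Q S T U V W : {group gT}.

Local Notation X := (p_residual p G).

Let sPG := normal_sub nsPG.
Let nPG := normal_norm nsPG.

(** With [W = M * Q], the index of [M] in [W] is prime to [p], so the normal
    [p]-subgroup [W :&: P] of [W] lies in [M]; hence [M :&: P = W :&: P]. *)
Lemma permutes_norm_setI M Q :
    M \subset G -> Q \subset G -> p^'.-group Q -> permutes M Q ->
  Q \subset 'N(M :&: P).
Proof.
move=> sMG sQG p'Q /eqP perMQ; pose W := (M <*> Q)%G.
have defW : M * Q = W by rewrite /= comm_joingE.
have sWG : W \subset G by rewrite join_subG sMG.
have sMW : M \subset W := joing_subl _ _.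
have nsWP : W :&: P <| W by rewrite /normal subsetIl normsI ?normG ?(subset_trans sWG).
have sWPM : W :&: P \subset M.
  rewrite -indexg_eq1; apply/eqP.
  have pWP : p.-group (W :&: P) := pgroupS (subsetIr _ _) pP.
  apply: (@pnat_1 p); first by rewrite -indexgI; exact: pnat_dvd (dvdn_indexg _ _) pWP.
  have p'W : p^'.-nat #|W : M|.
    rewrite -defW indexMg -indexgI; exact: pnat_dvd (dvdn_indexg _ _) p'Q.
  apply: pnat_dvd p'W; rewrite -indexMg -norm_joinEl; last first.
    exact: subset_trans sMW (normal_norm nsWP).
  by rewrite indexSg ?joing_subl // join_subG sMW subsetIl.
have -> : M :&: P = W :&: P.
  by apply/eqP; rewrite eqEsubset setSI //= subsetI sWPM subsetIr.
exact: subset_trans (joing_subr _ _) (normal_norm nsWP).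
Qed.

Lemma s_quasinormal_norm M : s_quasinormal G M -> X \subset 'N(M :&: P).
Proof.
case/s_quasinormalP=> sMG perM; apply/(@p_residualP _ p G 'N(M :&: P)%G) => Q sylQ p'Q.
by apply: permutes_norm_setI => //; [case/and3P: sylQ => _ -> | apply: perM].
Qed.

Lemma s_quasinormally_embedded_norm U :
  U \subset P -> s_quasinormally_embedded G U -> X \subset 'N(U).
Proof.
move=> sUP embU; have pU := pgroupS sUP pP.
have [U1|ntU] := eqVneq (U : {set gT}) 1; first by rewrite U1 norm1 subsetT.
have [K sqK sylU] := s_quasinormally_embedded_Sylow pr_p pU ntU embU.
have sUK := pHall_sub sylU.
have <- : K :&: P = U.
  apply: (sub_pHall (K := (K :&: P)%G) sylU); rewrite ?subsetIl ?subsetI ?sUK //.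
  exact: pgroupS (subsetIr _ _) pP.
exact: s_quasinormal_norm.
Qed.

(** A Sylow p'-subgroup [Q] need not permute with [U] when [p] does not divide the
    order of its normal closure; but then this normal closure meets [P]
    trivially and centralizes it. *)
Lemma tau_quasinormal_norm U :
  U \subset P -> tau_quasinormal G U -> X \subset 'N(U).
Proof.
move=> sUP /tau_quasinormalP[sUG perU]; have pU := pgroupS sUP pP.
apply/(@p_residualP _ p G 'N(U)%G) => Q sylQ p'Q.
have [q pr_q sylq] := SylowP _ _ sylQ; have [sQG qQ _] := and3P sylq.
have [Q1|ntQ] := eqVneq (Q : {set gT}) 1; first by rewrite Q1 sub1G.
have [_ qdQ _] := pgroup_pdiv qQ ntQ.
have neq_qp : q \in p^' := pgroupP p'Q q pr_q qdQ.
have [coUN|ncoUN] := boolP (coprime #|U| #|normal_closure Q G|).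
  have [U1|ntU] := eqVneq (U : {set gT}) 1; first by rewrite /= U1 norm1 subsetT.
  have [_ pdU _] := pgroup_pdiv pU ntU.
  pose N := [group of normal_closure Q G].
  have nsNG : N <| G := normal_closure_normal sQG.
  have sQN : Q \subset N := sub_normal_closure G Q.
  have p'N : p^'.-group N.
    rewrite p'groupEpi /= mem_primes pr_p cardG_gt0 /=.
    by apply: contraTN coUN => pdN; apply: prime_dvd2_not_coprime pdU pdN.
  have tiPN : P :&: N = 1 by apply: coprime_TIg; apply: pnat_coprime pP p'N.
  have cPN : N \subset 'C(P).
    apply/commG1P/trivgP; rewrite /= commGC -tiPN commg_subI // subsetI ?subxx /=.
      by rewrite (subset_trans sPG) ?normal_norm.
    by rewrite (subset_trans (normal_sub nsNG)).
  apply: cents_norm; apply: subset_trans sQN (subset_trans cPN _).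
  exact: centS.
have <- : U :&: P = U by apply/setIidPl.
apply: permutes_norm_setI => //; apply/eqP/(perU q) => //.
rewrite prime_coprime //; apply: contra neq_qp; exact: (pgroupP pU).
Qed.

Lemma core_norm (emb : {group gT} -> bool) L :
    (forall U, U \subset P -> emb U -> X \subset 'N(U)) -> L \subset P ->
  X \subset 'N(<<\bigcup_(A : {group gT} | (A \subset L) && emb A) A>>).
Proof.
move=> normU sLP; apply: norms_gen; apply: norms_bigcup; apply/bigcapsP=> U /andP[sUL embU].
by apply: normU => //; apply: subset_trans sUL sLP.
Qed.

(** Below a normal [p]-subgroup of [G], all embedding conditions become statements
    on subgroups normalized by O^p(G): with [N] from the definition, take
    [K = N :&: P] and use that [L :&: N] is the intersection of [N] with the
    core, and [L <*> K] that of [L * N] with [P]. *)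
Lemma triangle_norm L :
    L \subset P -> triangle G L ->
  exists K : {group gT}, [/\ K <| G, K \subset P,
    X \subset 'N(L <*> K) & X \subset 'N(L :&: K)].
Proof.
move=> sLP triL; have sLG := subset_trans sLP sPG.
have [N [nsNG sqLN [L0 [sL0L nXL0 sIL0]]]] : exists N : {group gT},
    [/\ N <| G, s_quasinormal G (L * N)
      & exists L0 : {group gT}, [/\ L0 \subset L, X \subset 'N(L0) & L :&: N \subset L0]].
  case: triL => -[_ [N [nsNG sqLN sIL]]]; exists N; split=> //.
    exists [group of se_core G L]; split=> //;
      last exact: core_norm s_quasinormally_embedded_norm sLP.
    by rewrite gen_subG; apply/bigcupsP=> U /andP[].
  exists [group of tau_core G L]; split=> //;
    last exact: core_norm tau_quasinormal_norm sLP.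
  by rewrite gen_subG; apply/bigcupsP=> U /andP[].
have [sNG nNG] := andP nsNG; have nNL := subset_trans sLG nNG.
exists (N :&: P)%G; split.
- by rewrite normalI.
- exact: subsetIr.
- rewrite -(norm_joinEl nNL) in sqLN.
  have -> : L <*> (N :&: P)%G = (L <*> N) :&: P.
    rewrite norm_joinEl; last by rewrite normsI // (subset_trans sLP) ?normG.
    by rewrite norm_joinEl // group_modl.
  exact: s_quasinormal_norm.
have -> : L :&: (N :&: P)%G = L0 :&: N.
  rewrite /= setIA; apply/eqP; rewrite eqEsubset subsetI.
  rewrite (subset_trans (subsetIl _ _) sIL0) (subset_trans (subsetIl _ _) (subsetIr _ _))
    /=.
  by rewrite !subsetI (subset_trans (subsetIl _ _)) // subsetIr (subset_trans (subsetIl _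
    _) (subset_trans sL0L sLP)).
by rewrite normsI // (subset_trans (p_residual_sub p G)).
Qed.

Local Notation R := (expg_residual p G).
Local Notation Y := (hcyc_residual p G).

Let sRG : R \subset G := normal_sub (expg_residual_normal p G).
Let sYG : Y \subset G := subset_trans (p_residual_sub _ _) sRG.
Let nsPhiG : 'Phi(P) <| G := char_normal_trans (Phi_char P) nsPG.

(** [G] is the product of O^p(G) and [S]. *)
Lemma normal_residual_Sylow S M : p.-Sylow(G) S -> M \subset G -> S \subset 'N(M) -> X
  \subset 'N(M) -> M <| G.
Proof.
move=> sylS sMG nMS nMX.
by rewrite /normal sMG -(p_residual_mulSylow pr_p sylS) mul_subG.
Qed.

(** The Frattini subgroup of [P / N1] is trivial. *)
Lemma maximal_separating N1 V0 :
    'Phi(P) \subset N1 -> N1 \subset P -> V0 \subset P -> ~~ (V0 \subset N1) ->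
  exists M : {group gT}, [/\ maximal M P, N1 \subset M & ~~ (V0 \subset M)].
Proof.
move=> sPhiN1 sN1P sV0P /subsetPn[v Vv nN1v].
have nsN1P : N1 <| P.
  apply: sub_der1_normal sN1P; apply: subset_trans sPhiN1.
  by rewrite (Phi_joing pP) joing_subl.
have nN1P := normal_norm nsN1P; have Pv := subsetP sV0P v Vv.
have Phi1 : 'Phi(P / N1) = 1 by rewrite -(quotient_Phi pP nN1P) quotientS1.
have [Mb maxMb nMbv] : exists2 Mb : {group coset_of N1}, maximal_eq Mb (P / N1) & coset
  N1 v \notin Mb.
  apply/exists_inP; apply: contraR nN1v => /exists_inPn allM.
  apply: coset_idr; first exact: subsetP Pv.
  suff: coset N1 v \in 'Phi(P / N1) by rewrite Phi1 => /set1P.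
  by apply/bigcapP=> Mb /allM; rewrite negbK.
case/orP: maxMb => [/eqP defMb|maxMb]; first by rewrite defMb mem_quotient in nMbv.
have sMbP := proper_sub (maxgroupp maxMb).
have [M defM sN1M sMP] := inv_quotientS nsN1P sMbP.
exists M; split=> //.
  rewrite -(quotient_maximal (K := N1)) -?defM //.
  exact: normalS sN1M sMP nsN1P.
apply: contra nMbv => sV0M; rewrite defM mem_quotient //.
exact: subsetP sV0M v Vv.
Qed.

(** It is enough to see that [[~: P, Y] <= N] for all normal subgroups [N] of [G]
    between ['Phi(P)] and [P], by induction on [#|P : N|]. Let [V0 / N] be a
    minimal normal subgroup of [G / N] inside [P / N], let [N1] be of index [p]
    in [V0], above [N] and normal in a Sylow [p]-subgroup [S] of [G], and let [M] be
    a maximal subgroup of [P] with [M :&: V0 = N1]. If O^p(G) normalizes [N1], so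
    does [G], and [#|V0 / N| = p]. Otherwise let [K] be given by the hypothesis
    on [M] and put [K' = K <*> N]. If [V0 <= K'], then O^p(G) would normalize
    [K' :&: M :&: V0 = N1], or [Y] acts trivially on [K' / N]. If not,
    [V0 :&: K' = N], and [Y] acts trivially on [P / K'] by induction, hence on
    [V0 / N]. *)
Lemma maximal_hcyc_cent :
    (forall M, maximal M P -> ~ ~ exists K : {group gT},
        [/\ K <| G, K \subset P, ~~ (K \subset M)
          & X \subset 'N(K :&: M) \/ [~: K, Y] \subset 'Phi(P)]) ->
  Y \subset 'C(P).
Proof.
move=> hypM; have nPR := subset_trans sRG nPG.
apply: comm_p_residual_Phi => //.
have nsub N (nsNG : N <| G) : Y \subset 'N(N) := subset_trans sYG (normal_norm nsNG).
suff claim N : N <| G -> 'Phi(P) \subset N -> N \subset P -> [~: P, Y] \subset N.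
  exact: (claim ('Phi(P))%G nsPhiG (subxx _) (Phi_sub P)).
have [n] := ubnP (#|P| - #|N|); elim: n N => // n IHn N; rewrite ltnS => len nsNG sPhiN sNP.
have [sNG nNG] := andP nsNG.
have [defN|prNP] := eqVproper sNP; first by rewrite defN commg_subl (subset_trans sYG).
have IH W : W <| G -> N \proper W -> W \subset P -> [~: P, Y] \subset W.
  move=> nsWG prNW sWP; apply: IHn => //; last exact: subset_trans sPhiN (proper_sub prNW).
  apply: leq_trans len; apply: ltn_sub2l; first exact: proper_card.
  exact: proper_card.
pose gP V := [&& V <| G, N \proper V & V \subset P].
have [|V0 /mingroupP[/and3P[nsVG prNV sVP] minV] _] := @mingroup_exists _ gP P.
  by rewrite /gP nsPG prNP subxx.
have [sVG nVG] := andP nsVG; have sNV := proper_sub prNV.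
have minV' W : W <| G -> N \subset W -> W \subset V0 -> W :=: N \/ W :=: V0.
  move=> nsWG sNW sWV; have [->|prNW] := eqVproper sNW; [by left | right].
  by apply: minV => //; rewrite /gP nsWG prNW (subset_trans sWV).
have sPV := IH V0 nsVG prNV sVP.
apply: (comm_hcyc_trans pP nsPG (subxx _) nsVG nsNG sVP sNV sPV).
apply/negPn/negP=> nb.
have [S sylS] := Sylow_exists p G; have [sSG pS _] := and3P sylS.
have sPS : P \subset S by apply: subset_trans (pcore_max pP nsPG) (pcore_sub_Hall sylS).
have nsNS : N <| S := normalS (subset_trans sNP sPS) sSG nsNG.
have nsVS : V0 <| S := normalS (subset_trans sVP sPS) sSG nsVG.
have nNS := normal_norm nsNS.
have pSN : p.-group (S / N) by apply: quotient_pgroup.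
have ntVN : V0 / N != 1.
  rewrite -subG1 quotient_sub1; first by case/andP: prNV.
  exact: subset_trans nNG.
have pVN : p.-group (V0 / N) := quotient_pgroup _ (pgroupS sVP pP).
have [_ _ [k oVN]] := pgroup_pdiv pVN ntVN.
have [|Qb [sQbV nsQbS oQb]] := @normal_pgroup p _ k (S / N)%G (V0 / N)%G pSN
  (quotient_normal N nsVS).
  by rewrite oVN pfactorK.
have [N1 defN1 sNN1 nsN1S] := inv_quotientN nsNS nsQbS.
have sN1S := normal_sub nsN1S.
have sN1V : N1 \subset V0.
  by rewrite -(quotientSGK _ sNV) -?defN1 // (subset_trans sN1S).
have iVN1 : #|V0 : N1| = p.
  have nNV := subset_trans sVG nNG; have nNN1 := subset_trans sN1V nNV.
  apply/eqP; rewrite -(eqn_pmul2r (indexg_gt0 N1 N)) (Lagrange_index sN1V sNN1).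
  by rewrite -!card_quotient // -defN1 oVN oQb expnS.
have nXN1 : ~~ (X \subset 'N(N1)).
  apply: contra nb => nN1X.
  have nsN1G := normal_residual_Sylow sylS (subset_trans sN1S sSG) (normal_norm nsN1S) nN1X.
  have [defN1'|N1V] := minV' N1 nsN1G sNN1 sN1V; last first.
    by move: iVN1; rewrite N1V indexgg => p1; have := pr_p; rewrite -p1.
  apply: comm_hcyc_prime => //; rewrite card_quotient ?(subset_trans sVG) //.
  by rewrite -iVN1 defN1'.
have nsVN1 : ~~ (V0 \subset N1) by rewrite -indexg_eq1 iVN1 neq_ltn prime_gt1 ?orbT.
have sPhiN1 := subset_trans sPhiN sNN1.
have [M [maxM sN1M nsVM]] := maximal_separating sPhiN1 (subset_trans sN1V sVP) sVP nsVN1.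
have defI : M :&: V0 = N1.
  apply/eqP; rewrite eq_sym eqEcard subsetI sN1M sN1V /=.
  have : #|V0 : M :&: V0| %| p by rewrite -iVN1 indexgS // subsetI sN1M.
  case/primeP: (pr_p) => _ dvp /dvp{dvp} /pred2P[/eqP|iI].
    by rewrite indexg_eq1 subsetI (negPf nsVM).
  rewrite -(leq_pmul2r (prime_gt0 pr_p)) -{1}iI -iVN1.
  by rewrite (Lagrange sN1V) Lagrange ?subsetIr.
apply: (hypM M maxM) => -[K [nsKG sKP nsKM hypK]].
(* The part of K above N: both alternatives for K pass to K'. *)
pose K' := (K <*> N)%G.
have nsK'G : K' <| G by apply: normalY.
have sK'P : K' \subset P by rewrite join_subG sKP.
have sNK' : N \subset K' := joing_subr _ _.
have nsK'M : ~~ (K' \subset M) by apply: contra nsKM; apply: subset_trans (joing_subl _ _).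
have nsIG : V0 :&: K' <| G by apply: normalI.
have sNI : N \subset V0 :&: K' by rewrite subsetI sNV.
have sNM := subset_trans sNN1 sN1M.
have [IN|IV] := minV' (V0 :&: K')%G nsIG sNI (subsetIl _ _).
  have prNK' : N \proper K'.
    by rewrite properE sNK'; apply: contra nsK'M => sK'N; apply: subset_trans sK'N sNM.
  have sIN : V0 :&: K' \subset N by rewrite [_ :&: _]IN.
  case/negP: nb; apply: subset_trans sIN; rewrite subsetI commg_subl nsub //=.
  exact: subset_trans (commSg _ sVP) (IH K' nsK'G prNK' sK'P).
have sVK' : V0 \subset K' by apply/setIidPl.
case: hypK => [nXKM|sKY].
  case/negP: nXN1; rewrite -defI.
  have <- : (K :&: M) <*> N :&: V0 = M :&: V0.
    have nNKM : K :&: M \subset 'N(N) by rewrite subIset // (subset_trans (normal_sub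
      nsKG)).
    have nNK : K \subset 'N(N) := subset_trans (normal_sub nsKG) nNG.
    have -> : (K :&: M) <*> N = M :&: K'.
      by rewrite norm_joinEl //= norm_joinEl // setIC group_modr.
    by rewrite -setIA (setIidPr sVK').
  have sXG := p_residual_sub p G.
  by rewrite normsI ?normsY // (subset_trans sXG).
case/negP: nb; apply: subset_trans (commSg _ sVK') _.
have nNK := subset_trans (normal_sub nsKG) nNG; have nNY := nsub N nsNG.
have nNK' := subset_trans (normal_sub nsK'G) nNG.
rewrite commGC -quotient_cents2 //= quotientYidr // quotient_cents2 // commGC.
exact: subset_trans sKY sPhiN.
Qed.

End NormalPSubgroup.

Section SmallSubgroups.

Variables (gT : finGroupType) (p : nat) (G : {group gT}).
Hypothesis pr_p : prime p.
Implicit Types A B K L M N P Q S T U V W : {group gT}.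

Local Notation X := (p_residual p G).
Local Notation R := (expg_residual p G).
Local Notation Y := (hcyc_residual p G).

Let sRG : R \subset G := normal_sub (expg_residual_normal p G).
Let sYG : Y \subset G := subset_trans (p_residual_sub _ _) sRG.

Lemma comm_hcyc_residual_normal P : P <| G -> [~: P, Y] <| G.
Proof.
case/andP=> sPG nPG; have nYG := normal_norm (hcyc_residual_normal p G).
rewrite /normal normsR // andbT (subset_trans (commgSS sPG sYG)) //.
by rewrite commg_subl normG.
Qed.

(** In a minimal counterexample [Y] centralizes all smaller normal subgroups of
    [G] inside [P], and [[~: P, Y] = P]. Hence the hypothesis applies to every
    nontrivial element of [P] by [comm_exponent], and among the normal subgroups
    of [G] properly contained in [P] there is a largest one [R0]. Choose [x] in
    [P] with nontrivial image in the center of [S / R0], [S] a Sylow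
    [p]-subgroup of [G]. If O^p(G) normalizes [M = <[x]> <*> R0], then [M = P],
    so [P / R0] has order [p] and [[~: P, Y] <= R0]; this contradiction is the
    outcome of all three cases. *)
Lemma small_hcyc_cent P :
    P <| G -> p.-group P ->
    (forall x, x \in P -> small_order p P x ->
      ~ ~ [\/ #[x] = 4 /\ <[x]> \subset hypercenter G,
             exists K : {group gT},
               [/\ K <| G, X \subset 'N(<[x]> <*> K) & X \subset 'N(<[x]> :&: K)]
           | has_supersolvable_supplement G <[x]>]) ->
  Y \subset 'C(P).
Proof.
have [n] := ubnP #|P|; elim: n P => // n IHn P; rewrite ltnS => len nsPG pP hypP.
have [sPG nPG] := andP nsPG.
have nsub N (nsNG : N <| G) : Y \subset 'N(N) := subset_trans sYG (normal_norm nsNG).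
apply/negPn/negP=> nb.
have cprop W : W <| G -> W \proper P -> Y \subset 'C(W).
  move=> nsWG prWP; have sWP := proper_sub prWP; apply: IHn => //.
  - exact: leq_trans (proper_card prWP) len.
  - exact: pgroupS pP.
  move=> x Wx sx; apply: hypP; first exact: subsetP Wx.
  move: sx; rewrite /small_order => /orP[->//|/and3P[-> -> nab]].
  by rewrite (contra (abelianS sWP) nab) orbT.
have ntP : P :!=: 1 by apply: contraNneq nb => ->; apply: cents1.
have sRP : [~: P, Y] \subset P by rewrite commg_subl nsub.
have nsRG := comm_hcyc_residual_normal nsPG.
have [defP|prR] := eqVproper sRP; last first.
  case/negP: nb; rewrite centsC; apply/commG1P/trivgP.
  apply: (@comm_hcyc_trans p _ G P pP P [~: P, Y]%G 1%G) => //; rewrite ?normal1 ?sub1G //.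
  have/commG1P-> // : [~: P, Y] \subset 'C(Y).
  by rewrite centsC; apply: (cprop [~: P, Y]%G).
have nsPhiG : 'Phi(P) <| G := char_normal_trans (Phi_char P) nsPG.
have cPhi := cprop _ nsPhiG (Phi_proper ntP).
have expP := @comm_exponent _ p pr_p P (hcyc_residual_group p G) pP defP cPhi.
pose gP V := (V <| G) && (V \proper P).
have [|R0 /maxgroupP[/andP[nsR0G prR0P] maxR0] _] := @maxgroup_exists _ gP 1%G.
  by rewrite /gP normal1 proper1G.
have [sR0G nR0G] := andP nsR0G; have sR0P := proper_sub prR0P.
have contraR0 : ~~ ([~: P, Y] \subset R0) by rewrite defP; case/andP: prR0P.
have maxR0' W : W <| G -> W \subset P -> W \subset R0 \/ W :=: P.
  move=> nsWG sWP; have [->|prWP] := eqVproper sWP; [by right | left].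
  have sJP : W <*> R0 \subset P by rewrite join_subG sWP.
  have [defJ|prJ] := eqVproper sJP.
    case/negP: nb; rewrite centsC -defJ join_subG ![_ \subset 'C(Y)]centsC.
    by rewrite !cprop.
  rewrite -(maxR0 (W <*> R0)%G) ?joing_subl ?joing_subr //.
  by rewrite /gP normalY.
have sPhiR0 : 'Phi(P) \subset R0.
  have [//|PhiP] := maxR0' _ nsPhiG (Phi_sub P).
  by have := Phi_proper ntP; rewrite PhiP properxx.
have [S sylS] := Sylow_exists p G; have [sSG pS _] := and3P sylS.
have sPS : P \subset S by apply: subset_trans (pcore_max pP nsPG) (pcore_sub_Hall sylS).
have sR0S := subset_trans sR0P sPS.
have nsR0S : R0 <| S := normalS sR0S sSG nsR0G.
have nsPS : P <| S := normalS sPS sSG nsPG.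
have nR0P := subset_trans sPG nR0G.
have ntPR : P / R0 != 1.
  by rewrite -subG1 quotient_sub1 //; case/andP: prR0P.
have /trivgPn[xb /setIP[Pxb Zxb] ntxb] :=
  meet_center_nil (pgroup_nil (quotient_pgroup R0 pS)) (quotient_normal R0 nsPS) ntPR.
case/morphimP: Pxb Zxb ntxb => x nR0x Px -> Zxb ntxb.
pose L := <[x]>%G; pose M := (L <*> R0)%G.
have sLP : L \subset P by rewrite cycle_subG.
have nR0L := subset_trans sLP nR0P.
have MR0 : M / R0 = <[coset R0 x]>.
  by rewrite /= quotientYidr // quotient_cycle.
have sMP : M \subset P by rewrite join_subG sLP.
have sR0M : R0 \subset M := joing_subr _ _.
have nsR0M : R0 <| M := normalS sR0M (subset_trans sMP sPG) nsR0G.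
have nMS : S \subset 'N(M).
  apply: normal_norm; rewrite -(quotientGK nsR0M) -(quotientGK nsR0S) cosetpre_normal.
  by rewrite MR0 sub_center_normal // cycle_subG.
have nsMR0 : ~~ (M \subset R0).
  apply: contra ntxb => sMR0; apply/eqP; apply: coset_id.
  by rewrite (subsetP sMR0) // (subsetP (joing_subl _ _)) // cycle_id.
have neqMP : M :!=: P.
  apply: contra contraR0 => /eqP defM; apply: comm_hcyc_prime => //.
  rewrite -defM MR0 -orderE order_dvdn -morphX //; apply/eqP/coset_id/(subsetP sPhiR0).
  exact: abelem_Phi_expg.
have nMX : ~~ (X \subset 'N(M)).
  apply: contra neqMP => nMX; apply/eqP.
  have nsMG := normal_residual_Sylow pr_p sylS (subset_trans sMP sPG) nMS nMX.
  by have [sMR0|//] := maxR0' M nsMG sMP; rewrite sMR0 in nsMR0.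
have sXG := p_residual_sub p G.
have small_x : small_order p P x.
  apply: expg_small_exponent => //; first exact: expP.
  by move=> x1; rewrite x1 morph1 eqxx in ntxb.
apply: (hypP x Px small_x) => -[[_ sLZ]|[K [nsKG nXLK nXLIK]]|[T [sTG defG ssT]]].
- have nsZG : hypercenter G <| G := ucn_normal _ _.
  have nsI : P :&: hypercenter G <| G by apply: normalI.
  have [sIR0|IP] := maxR0' _ nsI (subsetIl _ _).
    case/negP: nsMR0; rewrite join_subG subxx andbT.
    by apply: subset_trans sIR0; rewrite subsetI sLP.
  have sPZ : P \subset 'Z_(#|G|)(G) by apply/setIidPl.
  have {sPZ}: P \subset 'Z_0(G).
    elim: #|G| sPZ => // m IHm sPZ; apply: IHm; rewrite -defP.
    exact: subset_trans (commgSS sPZ sYG) (ucn_comm m G).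
  by rewrite ucn0 subG1 (negPf ntP).
- case/negP: nMX; have nsI : K :&: P <| G by apply: normalI.
  have [sIR0|IP] := maxR0' _ nsI (subsetIr _ _); last first.
    have sLK : L \subset K by apply: subset_trans sLP _; rewrite -IP subsetIl.
    by rewrite (setIidPl sLK) in nXLIK; rewrite normsY // (subset_trans sXG).
  have nKL : L \subset 'N(K) := subset_trans sLP (subset_trans sPG (normal_norm nsKG)).
  have defM : ((L <*> K) :&: P) <*> R0 = M.
    rewrite norm_joinEl // -group_modl // -norm_joinEl; last first.
      by rewrite normsI // (subset_trans sLP) ?normG.
    by rewrite -joingA (joing_idPr sIR0).
  rewrite -defM; apply: normsY (subset_trans sXG nR0G).
  exact: normsI nXLK (subset_trans sXG nPG).
pose W := ((P :&: T) <*> R0)%G.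
have sWP : W \subset P by rewrite join_subG subsetIl.
have defPT : P * T = G.
  apply/eqP; rewrite eqEsubset mul_subG //= -{1}defG; exact: mulSg.
have sWY := comm_hcyc_supplement pr_p nsPG pP ssT sTG defPT.
have nPT : T \subset 'N(P) := subset_trans sTG nPG.
have nsWG : W <| G.
  apply: (supplement_norm_sub nsPG pP defPT) => //.
    exact: subset_trans sPhiR0 (joing_subr _ _).
  by rewrite normsY ?normsI ?normG // (subset_trans sTG).
have [sWR0|defW] := maxR0' W nsWG sWP.
  case/negP: neqMP; rewrite eqEsubset sMP /=.
  have <- : L * (T :&: P) = P by rewrite group_modl // defG; apply/setIidPr.
  rewrite mul_subG ?joing_subl //; apply: subset_trans sR0M; apply: subset_trans sWR0.
  by rewrite setIC joing_subl.
case/negP: contraR0; rewrite -defW commGC -quotient_cents2 ?nsub //; last first.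
  exact: subset_trans sWP nR0P.
rewrite quotientYidr; last by rewrite subIset // nR0P.
rewrite quotient_cents2 ?nsub //; last by rewrite subIset // nR0P.
by rewrite commGC; apply: subset_trans sWY sPhiR0.
Qed.

End SmallSubgroups.

Section EmbeddingConditions.

Variables (gT : finGroupType) (p : nat) (G P : {group gT}).
Hypotheses (pr_p : prime p) (nsPG : P <| G) (pP : p.-group P).
Implicit Types K L M T : {group gT}.

Local Notation X := (p_residual p G).
Local Notation R := (expg_residual p G).
Local Notation Y := (hcyc_residual p G).

Let sPG := normal_sub nsPG.
Let nPG := normal_norm nsPG.
Let sRG : R \subset G := normal_sub (expg_residual_normal p G).
Let nsPhiG : 'Phi(P) <| G := char_normal_trans (Phi_char P) nsPG.

Lemma cyclic_hcyc_cent : cyclic P -> Y \subset 'C(P).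
Proof.
case/cyclicP=> x defP; apply: comm_p_residual_Phi => //; first exact: subset_trans sRG nPG.
apply: comm_hcyc_prime => //; first exact: Phi_sub.
have Px : x \in P by rewrite defP cycle_id.
have nx := subsetP (normal_norm (Phi_normal P)) x Px.
have -> : P / 'Phi(P) = <[coset 'Phi(P) x]> by rewrite -quotient_cycle // -defP.
rewrite -orderE order_dvdn -morphX //.
by apply/eqP/coset_id; apply: abelem_Phi_expg.
Qed.

(** The subgroup [K] needed for [maximal_hcyc_cent] is [(P :&: T) <*> 'Phi(P)] for
    a supersolvable supplement [T] of [M]; otherwise it is the one given by
    [triangle_norm], or [P] itself if that one lies in [M], since then
    [M = M <*> K] is normalized by O^p(G). *)
Lemma maximal_condition_hcyc_cent : maximal_condition G P -> Y \subset 'C(P).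
Proof.
move=> condP; apply: (maximal_hcyc_cent pr_p nsPG pP) => M maxM noK.
have sMP := proper_sub (maxgroupp maxM).
have nsPM : ~~ (P \subset M) by case/andP: (maxgroupp maxM).
have [|K [nsKG sKP nXMK nXMIK]] := triangle_norm pr_p nsPG pP sMP (condP M maxM _).
  case=> T [sTG defG ssT]; apply: noK.
  have defPT : P * T = G.
    by apply/eqP; rewrite eqEsubset mul_subG //= -{1}defG; apply: mulSg.
  exists ((P :&: T) <*> 'Phi(P))%G; split.
  - apply: (supplement_norm_sub nsPG pP defPT); first exact: joing_subr.
      by rewrite join_subG subsetIl Phi_sub.
    by rewrite normsY ?normsI ?normG ?(subset_trans sTG) ?(normal_norm nsPhiG).
  - by rewrite join_subG subsetIl Phi_sub.
  - apply: contra nsPM => sKM.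
    have <- : M * (T :&: P) = P by rewrite group_modl // defG; apply/setIidPr.
    by rewrite mul_subG // setIC; apply: subset_trans sKM; apply: joing_subl.
  right; have sYG : Y \subset G := subset_trans (p_residual_sub _ _) sRG.
  have nPhiG := normal_norm nsPhiG; have nPhiY := subset_trans sYG nPhiG.
  have nPhiPT : P :&: T \subset 'N('Phi(P)) by rewrite subIset // (subset_trans sPG).
  rewrite commGC -quotient_cents2 //; last by rewrite join_subG nPhiPT normG.
  by rewrite quotientYidr // quotient_cents2 // commGC comm_hcyc_supplement.
apply: noK; have [sKM|nsKM] := boolP (K \subset M).
  exists P; split=> //; left.
  by rewrite (setIidPr sMP) -(joing_idPl sKM).
by exists K; split=> //; left; rewrite setIC.
Qed.

Lemma small_condition_hcyc_cent : small_condition G p P -> Y \subset 'C(P).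
Proof.
move=> condP; apply: (small_hcyc_cent pr_p nsPG pP) => x Px small_x noX.
have sLP : <[x]> \subset P by rewrite cycle_subG.
have [||K [nsKG _ nXLK nXLIK]] := triangle_norm pr_p nsPG pP sLP (condP <[x]>%G sLP
  (cycle_cyclic x) _ _).
- move: small_x; rewrite /small_order => /orP[/eqP ox|/and3P[/eqP ox /eqP p2 nab]].
    by left; rewrite -orderE ox.
  by right; split=> //; apply/negP=> sLZ; apply: noX; constructor 1.
- by move=> suppL; apply: noX; constructor 3.
by apply: noX; constructor 2; exists K.
Qed.

End EmbeddingConditions.

(** * Chief p-factors of prime order *)

Section Eigenvector.
Import GRing.Theory.
Local Open Scope ring_scope.

(** ['X^p - 'X] is the product of all ['X - a%:P]. *)
Lemma Fp_eigenvector p n (A : 'M['F_p]_n.+1) :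
  prime p -> A ^+ p = A -> exists a, exists2 u : 'rV_n.+1, u != 0 & u *m A = a *: u.
Proof.
move=> pr_p Ap.
have : \prod_(a : 'F_p) \det (A - a%:M) = 0.
  transitivity (\det (\prod_(a : 'F_p) (A - a%:M))).
    by rewrite (big_morph (@determinant _ _) (@detM _ _) (@det1 _ _)).
  suff -> : \prod_(a : 'F_p) (A - a%:M) = 0 by rewrite det0.
  transitivity (horner_mx A (\prod_(a : 'F_p) ('X - a%:P))).
    rewrite rmorph_prod; apply: eq_bigr => a _.
    by rewrite rmorphB /= horner_mx_X horner_mx_C.
  by rewrite -finField_genPoly rmorphB /= rmorphXn /= horner_mx_X card_Fp // Ap subrr.
move/eqP/prodf_eq0=> [a _ /det0P[u ntu]].
rewrite mulmxBr mul_mx_scalar => /eqP; rewrite subr_eq0 => /eqP uA.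
by exists a; exists u.
Qed.

End Eigenvector.


Section IrreduciblePGroup.

Variables (gT : finGroupType) (p : nat) (G V : {group gT}).
Hypotheses (pr_p : prime p) (minV : minnormal V G) (pV : p.-group V).

Let ntV : V :!=: 1. Proof. by case/mingroupp/andP: minV. Qed.
Let nVG : G \subset 'N(V). Proof. by case/mingroupp/andP: minV. Qed.

Let abV : p.-abelem V.
Proof.
have [_ _ /is_abelemP[q pr_q abq]] := minnormal_solvable minV (subxx V) (pgroup_sol pV).
have [_ pdV _] := pgroup_pdiv pV ntV.
have /eqnP -> // : p \in (q : nat_pred) := pgroupP (abelem_pgroup abq) p pr_p pdV.
Qed.

Lemma power_eigenvector g :
  g \in G -> g ^+ p.-1 \in 'C(V) -> exists a, exists2 v, v \in V^# & v ^ g = v ^+ a.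
Proof.
move=> Gg cVg; pose rG := abelem_repr abV ntV nVG.
have rgp : (rG g ^+ p = rG g)%R.
  have : g ^+ p.-1 \in rker rG by rewrite rker_abelem inE groupX.
  case/rkerP=> _ rg1.
  have gp : g ^+ p = g * g ^+ p.-1 by rewrite -expgS prednK ?prime_gt0.
  by rewrite -repr_mxX // gp repr_mxM ?groupX // rg1 mulmx1.
have [a [u ntu uA]] := Fp_eigenvector pr_p rgp.
exists (a : nat); exists (rVabelem abV ntV u).
  rewrite !inE mem_rVabelem andbT; apply: contra ntu => /eqP v1.
  by apply/eqP/(@rVabelem_inj _ _ _ abV ntV); rewrite v1 rVabelem0.
by rewrite -(rVabelemJ abV ntV nVG u Gg) -[(_ *m _)%R]/(u *m rG g)%R uA rVabelemZ.
Qed.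

(** [R0] induces a normal [p]-subgroup on [V], so it centralizes [V]; the group
    induced by [G] is then abelian of exponent dividing [p.-1]. For [g] in [G] with
    an eigenvector as in [power_eigenvector], the elements [x] of [V] with
    [x ^ g = x ^+ a] form a normal subgroup of [G], hence all of [V], and [g]
    normalizes every subgroup of [V]. *)
Lemma minnormal_prime (R0 Y0 : {group gT}) :
    R0 <| G -> G^`(1) \subset R0 -> {in G, forall g, g ^+ p.-1 \in R0} ->
    Y0 \subset R0 -> Y0 \subset 'C(V) -> p.-nat #|R0 : Y0| ->
  #|V| = p.
Proof.
move=> nsRG sG'R sXR sYR cYV iRY; have [sRG nRG] := andP nsRG.
have [_ minV'] := mingroupP minV.
have cRV : R0 \subset 'C(V).
  have [S sylS] := Sylow_exists p R0; have [sSR pS _] := and3P sylS.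
  have defR : Y0 * S = R0.
    by apply: coprime_index_mulG => //; apply: pnat_coprime iRY _; case/and3P: sylS.
  have nVS : S \subset 'N(V) := subset_trans sSR (subset_trans sRG nVG).
  have pVS : p.-group (V <*> S) by rewrite norm_joinEr // pgroupM pV.
  have nsV : V <| V <*> S by rewrite /normal joing_subl join_subG normG.
  (* R0 acts on V as the p-group S does, so it has nontrivial fixed points. *)
  have ntC : 'C_V(R0) != 1.
    apply: contra (meet_center_nil (pgroup_nil pVS) nsV ntV) => /eqP C1.
    have sZS : 'Z(V <*> S) \subset 'C(S).
      by apply: subset_trans (centS (joing_subr V S)); apply: subsetIr.
    have cVY : V \subset 'C(Y0) by rewrite centsC.
    rewrite -subG1 -C1 subsetI subsetIl -defR centM subsetI.
    by rewrite (subset_trans (subsetIl _ _) cVY) (subset_trans (subsetIr _ _) sZS).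
  have nC : G \subset 'N('C_V(R0)) by rewrite normsI ?norms_cent.
  have CV : 'C_V(R0) = V.
    by apply: (minV' ('C_V(R0))%G); rewrite ?ntC ?subsetIl.
  by rewrite centsC -CV subsetIr.
have [v Vv ntv] := trivgPn _ ntV.
have nv g : g \in G -> <[v]> :^ g \subset <[v]>.
  move=> Gg; have [|a [w /setD1P[ntw Vw] wg]] := power_eigenvector Gg.
    by apply: (subsetP cRV); apply: sXR.
  have cVV : abelian V by case/and3P: abV.
  have gW : group_set [set x in V | x ^ g == x ^+ a].
    apply/group_setP; split=> [|x y]; first by rewrite inE group1 conj1g expg1n eqxx.
    rewrite !inE => /andP[Vx /eqP xg] /andP[Vy /eqP yg]; rewrite groupM //=.
    by rewrite conjMg xg yg expgMn //; apply: (centsP cVV).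
  pose W := Group gW.
  have sWV : W \subset V by apply/subsetP=> x; rewrite inE => /andP[].
  have nWG : G \subset 'N(W).
    apply/subsetP=> h Gh; rewrite inE; apply/subsetP=> _ /imsetP[x Wx ->].
    move: Wx; rewrite !inE => /andP[Vx /eqP xg].
    rewrite memJ_norm ?(subsetP nVG) // Vx /= -conjXg -xg -!conjgM.
    have Vxgh : x ^ (g * h) \in V by rewrite memJ_norm ?(subsetP nVG) // groupM.
    rewrite commgC conjgM; apply/eqP/conjg_fixP/commgP.
    have cR : [~ h, g] \in 'C(V) by rewrite (subsetP cRV) // (subsetP sG'R) // mem_commg.
    exact/commute_sym/(centP cR).
  have WV : W :=: V.
    apply: minV' => //; rewrite nWG andbT; apply/trivgPn; exists w => //.
    by rewrite inE Vw wg eqxx.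
  have : v \in W by rewrite WV.
  by rewrite inE => /andP[_ /eqP vg]; rewrite -cycleJ vg cycle_subG mem_cycle.
have Vcyc : <[v]> = V.
  apply: (minV' <[v]>%G); last by rewrite cycle_subG.
  rewrite /= cycle_eq1 ntv /=; apply/subsetP=> g Gg; rewrite inE; exact: nv.
by rewrite -Vcyc -orderE (abelem_order_p abV).
Qed.

End IrreduciblePGroup.

(** * Saturated formations *)

Lemma supersolvable_cyclic_ext (gT : finGroupType) (G A : {group gT}) :
  A <| G -> cyclic A -> cyclic (G / A) -> supersolvable G.
Proof.
move=> nsAG cycA cycGA; have [sAG nAG] := andP nsAG.
exists [:: A; G] => //=; rewrite /cyclic_factor /invariant_factor /= !normG nAG nsAG cycGA.
rewrite norms1 normal1 /= -(isog_cyclic (quotient1_isog A)) cycA //.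
Qed.

(** Adjoin generators one at a time. *)
Lemma abelian_supersolvable (gT : finGroupType) (G : {group gT}) : abelian G ->
  supersolvable G.
Proof.
move=> abG.
suff ser (U : {group gT}) : U \subset G -> exists2 s : seq {group gT},
    (cyclic_factor G).-series U s & last U s = G by apply: (ser 1%G); apply: sub1G.
have [n] := ubnP (#|G| - #|U|); elim: n U => // n IHn U; rewrite ltnS => len sUG.
have [defU|/andP[_ /subsetPn[x Gx nUx]]] := eqVproper sUG.
  by exists [::] => //; apply: val_inj.
pose V := (U <*> <[x]>)%G.
have sVG : V \subset G by rewrite join_subG sUG cycle_subG.
have nsub (W : {group gT}) : W \subset G -> G \subset 'N(W).
  by move=> sWG; apply: cents_norm; apply: subset_trans abG (centS sWG).
have nUx' : <[x]> \subset 'N(U) by rewrite cycle_subG (subsetP (nsub U sUG)).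
have nsUV : U <| V by rewrite /normal joing_subl (subset_trans sVG) ?nsub.
have ltUV : #|U| < #|V|.
  apply: proper_card; rewrite properE joing_subl /=; apply: contra nUx => sVU.
  by rewrite (subsetP sVU) // (subsetP (joing_subr _ _)) // cycle_id.
have [|s sers lasts] := IHn V _ sVG.
  apply: leq_trans len; apply: ltn_sub2l => //.
  exact: leq_trans ltUV (subset_leq_card sVG).
exists (V :: s) => //=;
  rewrite sers andbT /cyclic_factor /invariant_factor !nsub //= nsUV /=.
apply/(cyclic_quotientP nsUV); exists x;
  first by rewrite (subsetP (joing_subr _ _)) ?cycle_id.
by rewrite /= norm_joinEr.
Qed.

Section Formation.

Variable F : group_class.
Hypotheses (satF : saturated_formation F)
  (supersolvableF : forall (aT : finGroupType) (A : {group aT}), supersolvable A -> F A).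

Lemma formation_isog (aT rT : finGroupType) (G : {group aT}) (H : {group rT}) :
  G \isog H -> F G -> F H.
Proof. by case: satF => -[isoF _ _] _; apply: isoF. Qed.

Lemma formation_quotient (gT : finGroupType) (G N : {group gT}) : N <| G -> F G -> F (G /
  N).
Proof. by case: satF => -[_ quoF _] _; apply: quoF. Qed.

Lemma formation_quotientI (gT : finGroupType) (G M N : {group gT}) :
  M <| G -> N <| G -> F (G / M) -> F (G / N) -> F (G / (M :&: N)).
Proof. by case: satF => -[_ _ subF] _; apply: subF. Qed.

Lemma formation_quotientS (gT : finGroupType) (G M N : {group gT}) :
  M <| G -> N <| G -> M \subset N -> F (G / M) -> F (G / N).
Proof.
move=> nsMG nsNG sMN FGM; apply: (formation_isog (third_isog sMN nsMG nsNG)).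
apply: (@formation_quotient _ (G / M)%G (N / M)%G) => //; exact: quotient_normal.
Qed.

(** If [N <= 'Phi(G)] this is saturation. Otherwise a maximal subgroup [M] not
    containing [N] is a complement of [N], and [D = 'C_M(N)] is normal in [G]. As
    [G / D] is an extension of [N] by the cyclic group [G / 'C_G(N)], it is
    supersolvable, and [N :&: D = 1]. *)
Lemma formation_prime_normal (gT : finGroupType) (G N : {group gT}) :
  N <| G -> prime #|N| -> F (G / N) -> F G.
Proof.
move=> nsNG pr_N FGN; have [sNG nNG] := andP nsNG.
have [sNPhi|nsNPhi] := boolP (N \subset 'Phi(G)).
  case: satF => _; apply; apply: formation_quotientS FGN => //; exact: Phi_normal.
have [M maxM nsNM] : exists2 M : {group gT}, maximal M G & ~~ (N \subset M).
  apply/exists_inP; apply: contraR nsNPhi => /exists_inPn sNM.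
  apply/bigcapsP=> M /orP[/eqP->//|/sNM]; by rewrite negbK.
have sMG := proper_sub (maxgroupp maxM); have nNM := subset_trans sMG nNG.
have defG : N * M = G.
  rewrite -norm_joinEr //; have [_ maxM'] := maxgroupP maxM.
  have sJG : N <*> M \subset G by rewrite join_subG sNG.
  have [//|prJ] := eqVproper sJG.
  by case/negP: nsNM; rewrite -(maxM' (N <*> M)%G prJ) ?joing_subl ?joing_subr.
have tiNM : N :&: M = 1.
  by apply: prime_TIg.
pose D := ('C_M(N))%G.
have cDN : D \subset 'C(N) := subsetIr _ _.
have nsDG : D <| G.
  rewrite /normal subIset ?sMG //= -defG mul_subG //; first by apply: cents_norm;
    rewrite centsC.
  by rewrite normsI ?normG ?norms_cent.
have nDN : N \subset 'N(D) := subset_trans sNG (normal_norm nsDG).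
have defC : 'C_G(N) = N * D.
  have cNN : N \subset 'C(N) by apply: cyclic_abelian; apply: prime_cyclic.
  by rewrite /D /= setIC -{1}defG setIC -group_modl // setIC.
have ssGD : supersolvable (G / D).
  have nsND : (N <*> D)%G <| G by rewrite normalY.
  apply: (@supersolvable_cyclic_ext _ (G / D)%G ((N <*> D) / D)%G).
  - exact: quotient_normal.
  - by rewrite /= quotientYidr // quotient_cyclic ?prime_cyclic.
  rewrite /= (isog_cyclic (third_isog (joing_subr N D) nsDG nsND)).
  have -> : (N <*> D)%G = 'C_G(N)%G by apply: val_inj; rewrite /= norm_joinEl.
  have := first_isog_loc (conj_aut_morphism N) nNG; rewrite ker_conj_aut.
  move/isog_cyclic->.
  apply: cyclicS (Aut_prime_cyclic pr_N).
  by apply/subsetP=> _ /morphimP[y _ _ ->]; apply: Aut_aut.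
have FGI := formation_quotientI nsNG nsDG FGN (supersolvableF ssGD).
have tiND : N :&: D = 1 by apply/trivgP; rewrite /= -tiNM setIS ?subsetIl.
rewrite tiND in FGI; apply: formation_isog FGI.
by rewrite isog_sym; apply: quotient1_isog.
Qed.


Lemma formation_prime_factor (gT : finGroupType) (G E U : {group gT}) :
  E <| G -> U <| G -> U \subset E -> prime #|E / U| -> F (G / E) -> F (G / U).
Proof.
move=> nsEG nsUG sUE pr_EU FGE.
apply: (@formation_prime_normal _ (G / U)%G (E / U)%G) => //; first exact: quotient_normal.
by apply: formation_isog FGE; rewrite isog_sym; apply: third_isog.
Qed.

(** [minnormal_prime] in [G / U]. *)
Lemma chief_factor_prime (gT : finGroupType) p (G E U : {group gT}) :
    prime p -> E <| G -> U <| G -> U \proper E ->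
    (forall W : {group gT}, W <| G -> U \subset W -> W \proper E -> W :=: U) ->
    p.-group (E / U) -> [~: E, hcyc_residual p G] \subset U ->
  #|E / U| = p.
Proof.
move=> pr_p nsEG nsUG prUE minE pEU sEY.
have [sEG nEG] := andP nsEG; have [sUG nUG] := andP nsUG; have sUE := proper_sub prUE.
pose R := expg_residual_group p G; pose Y := hcyc_residual_group p G.
have nsRG : R <| G := expg_residual_normal p G.
have sRG := normal_sub nsRG.
have sYR : Y \subset R := p_residual_sub _ _.
have [sG'R sXR] := elimT (expg_residualP p G R) (subxx R).
have minEU : minnormal (E / U)%G (G / U).
  apply/mingroupP; split.
    rewrite quotient_norms // andbT -subG1 quotient_sub1; first by case/andP: prUE.
    exact: subset_trans nUG.
  move=> Wb /andP[ntWb nWbG] sWbE.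
  have nsWb : Wb <| G / U by rewrite /normal nWbG (subset_trans sWbE) ?quotientS.
  have [W defWb sUW nsWG] := inv_quotientN nsUG nsWb.
  have sWE : W \subset E by rewrite -(quotientSGK _ sUE) -?defWb // (subset_trans
    (normal_sub nsWG)).
  have [WE|prWE] := eqVproper sWE; first by rewrite defWb WE.
  by case/eqP: ntWb; rewrite defWb (minE W) // trivg_quotient.
apply: (minnormal_prime pr_p minEU pEU (R0 := (R / U)%G) (Y0 := (Y / U)%G)).
- exact: quotient_normal.
- by rewrite -quotient_der // quotientS.
- by move=> _ /morphimP[g Ng Gg ->]; rewrite -morphX // mem_quotient // sXR.
- exact: quotientS.
- by rewrite quotient_cents2 ?(subset_trans sYR) ?(subset_trans sRG) ?(subset_trans sEG)
  // commGC.
apply: morphim_p_index; first exact: subset_trans sYR (subset_trans sRG nUG).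
exact: p_index_residual.
Qed.

(** All chief factors of [G] between [W] and [E] have order [p]. *)
Lemma formation_climb (gT : finGroupType) p (G E W : {group gT}) :
    prime p -> E <| G -> W <| G -> W \subset E -> p.-group (E / W) ->
    [~: E, hcyc_residual p G] \subset W -> F (G / E) -> F (G / W).
Proof.
move=> pr_p + nsWG; have [n] := ubnP #|E|; elim: n E => // n IHn E; rewrite ltnS => len.
move=> nsEG sWE pEW sEY FGE; have [defW|prWE] := eqVproper sWE.
  by have -> : W = E by apply: val_inj.
pose gP U := [&& U <| G, W \subset U & U \proper E].
have [|U /maxgroupP[/and3P[nsUG sWU prUE] maxU] _] := @maxgroup_exists _ gP W.
  by rewrite /gP nsWG subxx.
have sUE := proper_sub prUE.
have sUYW : [~: U, hcyc_residual p G] \subset W by apply: subset_trans (commSg _ sUE) sEY.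
have nWE := subset_trans (normal_sub nsEG) (normal_norm nsWG).
have oEU : #|E / U| = p.
  apply: (chief_factor_prime (G := G)) => //; last exact: subset_trans sEY sWU.
    move=> V nsVG sUV prVE; apply: maxU => //.
    by rewrite /gP nsVG (subset_trans sWU).
  have nUE := subset_trans (normal_sub nsEG) (normal_norm nsUG).
  move: pEW; rewrite /pgroup !card_quotient //; apply: pnat_dvd; exact: indexgS.
apply: IHn sUYW _ => //; first exact: leq_trans (proper_card prUE) len.
  exact: pgroupS (quotientS W sUE) pEW.
by apply: formation_prime_factor FGE => //; rewrite oEU.
Qed.

(** Climb from [G / R], with [R] the subgroup [expg_residual p G]: it is abelian,
    and [R / Y] is a [p]-group on which [Y] acts trivially. *)
Lemma formation_quotient_hcyc (gT : finGroupType) p (G : {group gT}) :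
  prime p -> F (G / hcyc_residual_group p G).
Proof.
move=> pr_p; pose R := expg_residual_group p G; pose Y := hcyc_residual_group p G.
have nsRG : R <| G := expg_residual_normal p G.
have nsYG : Y <| G := hcyc_residual_normal p G.
have sYR : Y \subset R := p_residual_sub _ _.
have nYR : R \subset 'N(Y) := subset_trans (normal_sub nsRG) (normal_norm nsYG).
apply: (@formation_climb _ p G R Y) => //.
- rewrite /pgroup card_quotient //; exact: p_index_residual.
- by rewrite commg_subr.
apply: supersolvableF; apply: abelian_supersolvable.
by apply: sub_der1_abelian; apply: joing_subl.
Qed.

(** Remove the Sylow subgroups of [D] one prime at a time. *)
Lemma formation_nilpotent_climb (gT : finGroupType) (G D : {group gT}) :
    D <| G -> nilpotent D ->
    (forall p, prime p -> hcyc_residual p G \subset 'C('O_p(D))) ->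
  F (G / D) -> F G.
Proof.
have [n] := ubnP #|D|; elim: n D => // n IHn D; rewrite ltnS => len nsDG nilD cYD FGD.
have [D1|ntD] := eqVneq (D : {set gT}) 1.
  apply: (formation_isog _ (FGD)); rewrite isog_sym D1; apply: quotient1_isog.
pose p := pdiv #|D|; have pr_p : prime p by rewrite pdiv_prime ?cardG_gt1.
have pD : p %| #|D| := pdiv_dvd _.
pose W := ('O_p^'(D))%G.
have sWD : W \subset D := pcore_sub _ _.
have nsWG : W <| G := char_normal_trans (pcore_char _ D) nsDG.
have [_ defD _ _] := dprodP (nilpotent_pcoreC p nilD).
have nWD := subset_trans (normal_sub nsDG) (normal_norm nsWG).
have defDW : D / W = 'O_p(D) / W by rewrite -{1}defD quotientMidr.
apply: (IHn W) => //.
- apply: leq_trans len; apply: proper_card; rewrite properEneq sWD andbT.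
  apply/eqP=> WD; have := pgroupP (pcore_pgroup p^' D) p pr_p.
  by rewrite -[#|'O_p^'(D)|]/#|W| WD pD => /(_ isT); rewrite !inE eqxx.
- exact: nilpotentS nilD.
- move=> q pr_q; apply: subset_trans (cYD q pr_q) _; apply: centS.
  apply: pcore_max (pcore_pgroup _ _) _.
  apply: normalS (normal_sub nsDG) (char_normal_trans (pcore_char q W) nsWG).
  exact: subset_trans (pcore_sub _ _) sWD.
apply: (formation_climb pr_p) FGD => //.
  by rewrite defDW quotient_pgroup // pcore_pgroup.
have nWY : hcyc_residual p G \subset 'N(W).
  exact: subset_trans (normal_sub (hcyc_residual_normal p G)) (normal_norm nsWG).
rewrite -quotient_cents2 // defDW quotient_cents // centsC; exact: cYD.
Qed.

End Formation.

Theorem theorem3p6 (F : group_class)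
  (satF : saturated_formation F)
  (supersolvableF : forall (aT : finGroupType) (A : {group aT}),
     supersolvable A -> F aT A)
  (gT : finGroupType) (G : {group gT}) :
  F gT G <->
  exists H : {group gT},
    [/\ H <| G,
        F _ (G / H)%G
      & forall (p : nat) (P : {group gT}),
          prime p -> p.-Sylow(generalized_Fitting H) P -> ~~ cyclic P ->
          (forall M : {group gT},
             maximal M P -> ~ has_supersolvable_supplement G M ->
             triangle G M)
          \/
          (forall L : {group gT},
             L \subset P -> cyclic L ->
             prime #|L| \/
             [/\ #|L| = 4, p = 2, ~~ abelian P
               & ~~ (L \subset hypercenter G)] ->
             ~ has_supersolvable_supplement G L ->
             triangle G L)].
Proof.
split=> [FG|[H [nsHG FGH condG]]].
  exists 1%G; split; first exact: normal1.
    exact: formation_isog (quotient1_isog G) FG.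
  move=> p P pr_p sylP /negP[].
  have [sP1 _ _] := and3P sylP.
  have sE1 : generalized_Fitting (1%G : {group gT}) \subset 1%G.
    by rewrite join_subG Fitting_sub layer_sub.
  by have/trivgP-> := subset_trans sP1 sE1; apply: cyclic1.
have layer1 : layer H = 1 := layer_trivial nsHG condG.
pose E := ('F(H))%G.
have defE : generalized_Fitting H = E by rewrite /generalized_Fitting layer1 joingG1.
have nsEG : E <| G := char_normal_trans (Fitting_char H) nsHG.
have nilE : nilpotent E := Fitting_nil H.
have nsOG p : 'O_p(E) <| G := char_normal_trans (pcore_char p E) nsEG.
(* For each prime p the Sylow subgroup of E is hypercyclically embedded in G. *)
have cYO p : prime p -> hcyc_residual p G \subset 'C('O_p(E)).
  move=> pr_p; have sylO : p.-Sylow(generalized_Fitting H) 'O_p(E).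
    by rewrite defE; apply: nilpotent_pcore_Hall.
  have pO : p.-group 'O_p(E) := pcore_pgroup p E.
  have [cycO|ncycO] := boolP (cyclic 'O_p(E)).
    by apply: (@cyclic_hcyc_cent _ p G 'O_p(E)%G) => //; apply: nsOG.
  have [condO|condO] := condG p 'O_p(E)%G pr_p sylO ncycO.
    by apply: (@maximal_condition_hcyc_cent _ p G 'O_p(E)%G) => //; apply: nsOG.
  by apply: (@small_condition_hcyc_cent _ p G 'O_p(E)%G) => //; apply: nsOG.
(* The quotient by H and those by the centralizers of the Sylow subgroups of E
   are in F; the intersection D of these kernels lies in the center of E. *)
have [D [nsDG FGD sDH cDO]] : exists D : {group gT},
    [/\ D <| G, F _ (G / D)%G, D \subset H
      & forall p, p \in primes #|E| -> D \subset 'C('O_p(E))].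
  have : all prime (primes #|E|) by apply/allP=> p; rewrite mem_primes => /andP[].
  elim: (primes _) => [_|p s IHs /= /andP[pr_p /IHs[D [nsDG FGD sDH cDO]]]];
    first by exists H.
  have nsCG : 'C_G('O_p(E)) <| G.
    by rewrite /normal subsetIl normsI ?normG // norms_cent // normal_norm.
  exists (D :&: 'C_G('O_p(E)))%G; split.
  - exact: normalI.
  - apply: (formation_quotientI satF nsDG nsCG FGD).
    have nsYG : hcyc_residual p G <| G := hcyc_residual_normal p G.
    apply: (formation_quotientS satF nsYG nsCG) (formation_quotient_hcyc satF
      supersolvableF G pr_p).
    by rewrite subsetI (normal_sub nsYG) cYO.
  - by rewrite subIset ?sDH.
  move=> q; rewrite inE => /predU1P[->|/cDO cDq].
    exact: subset_trans (subsetIr _ _) (subsetIr _ _).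
  exact: subset_trans (subsetIl _ _) cDq.
have sDE : D \subset E.
  apply: subset_trans (cent_Fitting_layer1 layer1); rewrite subsetI sDH /=.
  rewrite -/E -(nilpotent_Fitting nilE) FittingEgen cent_gen centsC.
  by apply/bigcupsP=> p piEp; rewrite centsC cDO.
apply: (formation_nilpotent_climb satF supersolvableF nsDG (nilpotentS sDE nilE) _ FGD)
  => p pr_p.
apply: subset_trans (cYO p pr_p) _; apply: centS.
apply: pcore_max (pcore_pgroup _ _) _.
apply: normalS (normal_sub nsEG) (char_normal_trans (pcore_char p D) nsDG).
exact: subset_trans (pcore_sub _ _) sDE.
Qed.
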